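(* There exists a universal constant $C>0$ such that the following holds. Let $n=n(m)$ be even and $p=p(n)\in(0,1/2]$ with $n\ge C\,m\log m$ and $np=\omega(1)$. Let $A$ be drawn from the $(m,n,p)$-Bernoulli ensemble and let $P$ be the event that each row of $A$ sums to an even number. Then $$\frac{\mathbb{E}[Z_0^2\mid P]}{\mathbb{E}[Z_0\mid P]^2}=\begin{cases}1+o(1), & \text{if } m=o(np),\\[2pt] \exp\left\{\Omega\left(\frac{m}{np}\right)\right\}, & \text{if } m=\Omega(np).\end{cases}$$
   Context: The $(m,n,p)$-Bernoulli ensemble is the law of an $m\times n$ random matrix with i.i.d. Bernoulli$(p)$ entries. $\mathcal{B}$ is the set of balanced vectors, i.e. $u\in\{-1,+1\}^n$ with $\sum_i u_i=0$. $Z_0$ is the number of $u\in\mathcal{B}$ with $Au=0$. Asymptotics are as $m\to\infty$ (hence $n\to\infty$). In the second case the meaning is that there is a constant $c>0$ such that the ratio is at least $\exp\{c\,m/(np)\}$ for all sufficiently large $m$. *)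

(* Defs.v *)
(* MathComp / MathComp-Analysis. *)
From HB Require Import structures.
From mathcomp Require Import all_boot all_order all_algebra.
From mathcomp Require Import all_classical all_reals all_analysis.

Set Implicit Arguments.
Unset Strict Implicit.
Unset Printing Implicit Defensive.

Import Order.TTheory GRing.Theory Num.Theory.
Import numFieldNormedType.Exports.

Local Open Scope ring_scope.

(* The sample space is the finite type of 0/1 matrices, entries being booleans
   ([true] is 1); this is the joint mass function of i.i.d. Bernoulli(p)
   entries. *)
Definition bernoulli_ensemble (R : realType) (m n : nat) (p : R)
    (A : 'M[bool]_(m, n)) : R :=
  \prod_(i < m) \prod_(j < n) bernoulli_pmf p (A i j).

Definition prob (R : realType) (m n : nat) (p : R)
    (E : {set 'M[bool]_(m, n)}) : R :=
  \sum_(A in E) bernoulli_ensemble p A.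

Definition condE (R : realType) (m n : nat) (p : R)
    (X : 'M[bool]_(m, n) -> R) (E : {set 'M[bool]_(m, n)}) : R :=
  (\sum_(A in E) bernoulli_ensemble p A * X A) / prob p E.

Definition int_of_bool_mx (m n : nat) (A : 'M[bool]_(m, n)) : 'M[int]_(m, n) :=
  \matrix_(i, j) (A i j)%:R.

(* Vectors of {-1, +1}^n are encoded by their sign bits: [true] is -1. *)
Definition sign_vec (n : nat) (u : 'cV[bool]_n) : 'cV[int]_n :=
  \col_i (-1) ^+ u i 0.

Definition balanced (n : nat) : {set 'cV[bool]_n} :=
  [set u : 'cV[bool]_n | \sum_(i < n) sign_vec u i 0 == 0]%SET.

Definition Z0 (m n : nat) (A : 'M[bool]_(m, n)) : nat :=
  #|[set u in balanced n | int_of_bool_mx A *m sign_vec u == 0]%SET|.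

Definition even_rows (m n : nat) : {set 'M[bool]_(m, n)} :=
  [set A : 'M[bool]_(m, n) | [forall i, ~~ odd (\sum_(j < n) A i j)]]%SET.

Definition second_moment_ratio (R : realType) (m n : nat) (p : R) : R :=
  condE p (fun A => (Z0 A)%:R ^+ 2) (even_rows m n) /
  condE p (fun A => (Z0 A)%:R) (even_rows m n) ^+ 2.

(* Main.v *)
Require Import Defs.
From HB Require Import structures.
From mathcomp Require Import all_boot all_order all_algebra.
From mathcomp Require Import all_classical all_reals all_analysis.
From mathcomp Require Import zify ring lra.

Set Implicit Arguments.
Unset Strict Implicit.
Unset Printing Implicit Defensive.

Import Order.TTheory GRing.Theory Num.Theory.
Import numFieldNormedType.Exports.

Local Open Scope classical_set_scope.
Local Open Scope ring_scope.

(** With z = 4 p (1 - p) and n = 2 N, let f_j be the probability that two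
    independent Bin(j, p) variables coincide.  A row is orthogonal to a balanced
    vector with probability f_N, and to two balanced vectors whose negative
    parts meet in k indices with probability f_k f_(N - k), so that the ratio is
    the mean of (P_e f_k f_(N - k) / f_N^2)^m over the hypergeometric overlap k,
    where P_e is the probability that a row has an even sum.

    Now f_j is the mean of (1 - z + z s)^j for the arcsine law of s, and
    integrating by parts gives a three-term recursion.  It shows that
    (j + 1) (1 - f_(j + 1) / f_j) tends to 1/2, with a correction of order
    1 / (z j).  Hence f_k f_(N - k) / f_N^2 is, for k away from 0 and N, at most
    2 exp (((2 k - N) / N)^2 + O(1 / (z N))), and, when z is small, at least
    2 exp (c / (z N)).  The overlap is subgaussian around N / 2, and n >= C m log m
    makes both the fluctuation term and the tail, on which only the crude bound
    (2 N)^(2 m) is available, negligible. *)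

(** * Moments of the arcsine law and the recursion for tie probabilities *)

Section ArcsineMoments.
Variable R : realType.

(** The moments of the arcsine law on [0, 1]; also the probability that 2 i fair coin flips split
    evenly. *)
Definition arcsine_moment (i : nat) : R := 'C(i.*2, i)%:R / 4 ^+ i.

Lemma arcsine_momentS i :
  i.+1%:R * arcsine_moment i.+1 = (i%:R + 2^-1) * arcsine_moment i.
Proof.
rewrite /arcsine_moment.
have H : (i.+1 * 'C(i.+1.*2, i.+1) = 2 * (i.*2.+1 * 'C(i.*2, i)))%N.
  have h1 := mul_bin_diag i.+1.*2 i.
  have h2 := mul_bin_diag i.*2.+1 i.
  have h3 : 'C(i.*2.+1, i.+1) = 'C(i.*2.+1, i).
    rewrite -[LHS]bin_sub; last by lia.
    by congr ('C(_, _)); lia.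
  rewrite doubleS /= h3 in h1 h2 *.
  by rewrite -h1 h2; lia.
have H' : i.+1%:R * 'C(i.+1.*2, i.+1)%:R = 2 * (i.*2.+1%:R * 'C(i.*2, i)%:R) :> R.
  by rewrite -!natrM H.
have e4 : (4 ^+ i : R) != 0 by rewrite expf_neq0.
have odd2 : i.*2.+1%:R = 2 * i%:R + 1 :> R by rewrite -natr1 -mul2n natrM.
rewrite [LHS]mulrA.
rewrite H' odd2 exprS; field.
by rewrite e4.
Qed.

Lemma arcsine_moment_gt0 i : 0 < arcsine_moment i.
Proof.
rewrite divr_gt0 ?exprn_gt0 // ltr0n bin_gt0.
by rewrite -addnn leq_addr.
Qed.

(** The expectation is encoded through the moments alone, as a linear functional on polynomials, so
    that no integral is involved. *)
Definition arcsine_mean (P : {poly R}) : R :=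
  \sum_(i < size P) P`_i * arcsine_moment i.

Lemma arcsine_mean_widen n (P : {poly R}) : (size P <= n)%N ->
  arcsine_mean P = \sum_(i < n) P`_i * arcsine_moment i.
Proof.
move=> sP; rewrite /arcsine_mean (big_ord_widen _ (fun i => P`_i * arcsine_moment i) sP).
rewrite big_mkcond; apply: eq_bigr => i _.
by case: ltnP => // ?; rewrite nth_default ?mul0r.
Qed.

Fact arcsine_mean_is_linear : linear_for *%R arcsine_mean.
Proof.
move=> a P Q; pose n := maxn (size P) (size Q).
have sPQ : (size (a *: P + Q)%R <= n)%N.
  rewrite (leq_trans (size_polyD _ _))// geq_max leq_max size_scale_leq.
  by rewrite leq_maxr.
rewrite !(@arcsine_mean_widen n) ?leq_maxl ?leq_maxr //.
rewrite mulr_sumr -big_split; apply: eq_bigr => i _ /=.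
by rewrite coefD coefZ mulrDl mulrA.
Qed.

HB.instance Definition _ :=
  GRing.isLinear.Build R {poly R} R *%R arcsine_mean arcsine_mean_is_linear.

Lemma arcsine_meanXn i : arcsine_mean 'X^i = arcsine_moment i.
Proof.
rewrite (@arcsine_mean_widen i.+1) ?size_polyXn // big_ord_recr /=.
rewrite coefXn eqxx mul1r big1 ?add0r // => j _.
by rewrite coefXn (ltn_eqF (ltn_ord j)) mul0r.
Qed.

(* Integration by parts against the arcsine density, proportional to
   (s (1 - s))^(-1/2). *)
Lemma arcsine_mean_by_parts (P : {poly R}) :
  arcsine_mean ('X * (1 - 'X) * P^`() + ((2^-1)%:P - 'X) * P) = 0.
Proof.
pose F (Q : {poly R}) := arcsine_mean ('X * (1 - 'X) * Q^`() + ((2^-1)%:P - 'X) * Q).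
have F_linear a (U V : {poly R}) : F (a *: U + V) = a * F U + F V.
  rewrite /F -linearP /= derivD derivZ; congr (arcsine_mean _).
  by rewrite -!mul_polyC; ring.
(* By linearity monomials suffice, and on them the identity is [arcsine_momentS]. *)
suff F0 i : F 'X^i = 0.
  rewrite -/(F P) -[P]coefK poly_def; elim/big_rec: _ => [|i Q _ IH].
    by rewrite /F deriv0 !mulr0 addr0 raddf0.
  by rewrite F_linear F0 IH mulr0 addr0.
rewrite /F derivXn.
have -> : 'X * (1 - 'X) * ('X^(i.-1) *+ i) + (2^-1%:P - 'X) * 'X^i
   = (i%:R + 2^-1) *: 'X^i - (i.+1%:R) *: 'X^(i.+1) :> {poly R}.
  have D : 'X * ('X^(i.-1) *+ i) = i%:R * 'X^i :> {poly R}.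
    by case: i => [|i]; rewrite ?mulr0n ?mulr0 ?mul0r // mulrnAr -exprS mulr_natl.
  rewrite mulrAC D -!mul_polyC -natr1 !polyCD polyC_natr exprS; ring.
rewrite linearB !linearZ /= !arcsine_meanXn -arcsine_momentS.
by rewrite -[_ *: _]/(_ * _) mulrN subrr.
Qed.


(* The probability that two independent Bin(j, p) variables coincide, written
   as the mean of (1 - z + z s)^j against the arcsine law, for z = 4 p (1 - p);
   see [coef_tie_prob]. *)
Definition tie_prob (z : R) (j : nat) : R :=
  arcsine_mean (((1 - z)%:P + z *: 'X) ^+ j).

Lemma tie_prob0 z : tie_prob z 0 = 1.
Proof.
by rewrite /tie_prob !expr0 -(expr0 'X) arcsine_meanXn /arcsine_moment expr0 divr1.
Qed.

(** Integration by parts applied to [g ^+ j] with g = 1 - z + z X: since z X = g - (1 - z),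
    multiplying by z leaves only powers of g. At j = 0 the truncated predecessor is harmless because
    of the factor [j%:R]. *)
Lemma tie_prob_rec z j :
  j.+1%:R * (tie_prob z j - tie_prob z j.+1) =
  z / 2 * tie_prob z j + (1 - z) * j%:R * (tie_prob z j.-1 - tie_prob z j).
Proof.
rewrite /tie_prob; set g := _ + _ *: _.
have := arcsine_mean_by_parts (g ^+ j).
have dg : g^`() = z%:P by rewrite /g derivD derivC derivZ derivX add0r alg_polyC.
rewrite deriv_exp dg => H.
have {H} : arcsine_mean (z *: ('X * (1 - 'X) * (z%:P * g ^+ j.-1 *+ j) +
    ((2^-1)%:P - 'X) * g ^+ j)) = 0 by rewrite linearZ /= H mulr0.
have -> : z *: ('X * (1 - 'X) * (z%:P * g ^+ j.-1 *+ j) + ((2^-1)%:P - 'X) * g ^+ j) =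
   j.+1%:R *: (g ^+ j - g ^+ j.+1) - (z / 2) *: g ^+ j
   - ((1 - z) * j%:R) *: (g ^+ j.-1 - g ^+ j).
  have gX : z%:P * 'X = g - (1 - z)%:P by rewrite /g mul_polyC addrAC subrr add0r.
  have gj : j%:R * (g * g ^+ j.-1) = j%:R * g ^+ j.
    by case: (j) => [|i]; rewrite ?mul0r // -exprS.
  rewrite -!mul_polyC !polyCM !polyCB -(@natr1 _ j) polyCD !polyC_natr polyC1 -mulr_natl exprS.
  transitivity (j%:R * (z%:P * 'X) * (z%:P - z%:P * 'X) * g ^+ j.-1 +
     (z%:P * 2^-1%:P - z%:P * 'X) * g ^+ j); first by ring.
  rewrite gX polyCB polyC1.
  have h2 : z%:P * 2^-1%:P + z%:P * 2^-1%:P = z%:P :> {poly R}.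
    by rewrite -polyCM -polyCD; congr polyC; field.
  transitivity ((1 - g) * (j%:R * (g * g ^+ j.-1)) - (1 - z%:P) * (1 - g) * (j%:R * g ^+ j.-1)
     + (z%:P * 2^-1%:P - g + (1 - z%:P)) * g ^+ j); first by ring.
  rewrite gj.
  have -> : z%:P * 2^-1%:P - g + (1 - z%:P) = 1 - g - z%:P * 2^-1%:P :> {poly R}.
    by rewrite -[in X in 1 - X]h2; ring.
  transitivity ((1 - g) * (j%:R * g ^+ j) - (1 - z%:P) * (j%:R * g ^+ j.-1)
    + (1 - z%:P) * (j%:R * (g * g ^+ j.-1))
     + (1 - g - z%:P * 2^-1%:P) * g ^+ j); first by ring.
  rewrite gj; ring.
rewrite !(linearB, linearZ) /= -![_ *: _]/(_ * _) => H.
by apply/eqP; rewrite -subr_eq0 -H; apply/eqP; ring.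
Qed.

Lemma tie_prob_sum z j : tie_prob z j =
  \sum_(i < j.+1) 'C(j, i)%:R * (1 - z) ^+ (j - i) * z ^+ i * arcsine_moment i.
Proof.
rewrite /tie_prob exprDn raddf_sum; apply: eq_bigr => i _.
rewrite raddfMn /= exprZn -polyC_exp mul_polyC !linearZ /= arcsine_meanXn.
by rewrite -[LHS]mulr_natl !mulrA.
Qed.

Lemma tie_prob_gt0 z j : 0 <= z <= 1 -> 0 < tie_prob z j.
Proof.
move=> /andP[z0 z1]; rewrite tie_prob_sum.
have T0 (i : 'I_j.+1) : 0 <= 'C(j, i)%:R * (1 - z) ^+ (j - i) * z ^+ i * arcsine_moment i.
  by rewrite !mulr_ge0 ?exprn_ge0 ?subr_ge0 // ltW ?arcsine_moment_gt0.
(* At z = 1 the powers of 1 - z vanish and positivity comes from the last term; otherwise it comes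
   from the first. *)
have [z10|z10] := eqVneq z 1.
  rewrite big_ord_recr ltr_wpDl ?sumr_ge0 // subnn expr0 binn !mul1r.
  by rewrite z10 expr1n mul1r arcsine_moment_gt0.
rewrite big_ord_recl ltr_pwDl ?sumr_ge0 // subn0 bin0 expr0 mul1r mulr1.
by rewrite mulr_gt0 ?arcsine_moment_gt0 // exprn_gt0 // subr_gt0 lt_neqAle z10.
Qed.

(* (q + p X) (p + q X) = (1 - z) X + (z / 4) (1 + X)^2 *)
Lemma coef_tie_prob (p : R) j :
  ((((1 - p)%:P + p *: 'X) * (p%:P + (1 - p) *: 'X)) ^+ j)`_j =
  tie_prob (4 * p * (1 - p)) j.
Proof.
set z := 4 * p * (1 - p).
have -> : ((1 - p)%:P + p *: 'X) * (p%:P + (1 - p) *: 'X) =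
  (1 - z)%:P * 'X + (z / 4)%:P * (1 + 'X) ^+ 2 :> {poly R}.
  have -> : z / 4 = p * (1 - p) by rewrite /z; field.
  rewrite /z -!mul_polyC !(polyCM, polyCB) polyC1 (_ : 4%:P = 4) ?polyC_natr //; ring.
clearbody z.
rewrite tie_prob_sum exprDn coef_sum; apply: eq_bigr => i _.
rewrite coefMn !exprMn -!polyC_exp mulrACA -polyCM coefCM.
have ij : (i <= j)%N by rewrite -ltnS.
(* Once X^(j - i) is split off, the coefficient of X^i in (1 + X)^(2 i) remains, which is the
   central binomial coefficient in [arcsine_moment]. *)
rewrite coefXnM ltnNge leq_subr /= subKn // -exprD addnn -mul2n [1 + 'X]addrC exprD1n coef_sum.
have i2 : (i < (2 * i).+1)%N by lia.
rewrite (bigD1 (Ordinal i2)) //= coefMn coefXn eqxx big1 ?addr0; last first.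
  move=> k /eqP kn; rewrite coefMn coefXn; case: eqP => [e|_]; last by rewrite mul0rn.
  by case: kn; apply/val_inj.
rewrite /arcsine_moment -mul2n expr_div_n -[LHS]mulr_natl.
by rewrite -[true%:R *+ 'C(2 * i, i)]/('C(2 * i, i)%:R); ring.
Qed.

End ArcsineMoments.

(** * Size of the relative decrements of the tie probabilities *)

Section TieProbBounds.
Variables (R : realType) (z : R).
Hypothesis z01 : 0 < z <= 1.

Local Notation f := (tie_prob z).

Let f_gt0 j : 0 < f j.
Proof. by case/andP: z01 => z0 z1; rewrite tie_prob_gt0 // (ltW z0). Qed.

(* f_j decays like j^(-1/2), so this quantity tends to 1/2. *)
Definition tie_drop (j : nat) : R := j.+1%:R * (1 - f j.+1 / f j).

Local Notation y := tie_drop.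

Lemma tie_probS j : f j.+1 = f j * (1 - y j / j.+1%:R).
Proof.
rewrite /tie_drop; field.
by rewrite !gt_eqF ?f_gt0.
Qed.

Lemma tie_drop0 : y 0 = z / 2.
Proof.
have := tie_prob_rec z 0; rewrite /tie_drop tie_prob0 divr1 mulr0 mul0r addr0 mulr1.
by [].
Qed.

Lemma tie_drop_lt j : y j < j.+1%:R.
Proof.
rewrite /tie_drop gtr_pMr // gtrBl divr_gt0 //.
Qed.

(** Division by f_(j + 1) turns the three-term recursion [tie_prob_rec] into a first-order one for
    [tie_drop] alone, on which the bounds below are proved by induction. *)
Lemma tie_dropS j :
  y j.+1 = z / 2 + (1 - z) * (y j * j.+1%:R / (j.+1%:R - y j)).
Proof.
have fn0 k : f k != 0 by rewrite gt_eqF.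
have J0 : j.+1%:R != 0 :> R by rewrite pnatr_eq0.
have Jy : j.+1%:R - y j != 0 by rewrite gt_eqF // subr_gt0 tie_drop_lt.
have := tie_prob_rec z j.+1; rewrite /= => H.
have -> : y j.+1 = (j.+2%:R * (f j.+1 - f j.+2)) / f j.+1.
  by rewrite /tie_drop; field; rewrite fn0.
rewrite {}H (tie_probS j); have := fn0 j; move: (f j) => a a0.
move: J0 Jy; move: (y j) => b; move: (j.+1%:R : R) => J J0 Jb.
by field; rewrite a0 J0 Jb.
Qed.

Lemma tie_drop_bounds j :
  [/\ 0 <= y j, y j <= j.+1%:R * (z / 2) & y j <= 1].
Proof.
case/andP: z01 => z0 z1.
elim: j => [|j [IH0 IHz IH1]].
  by rewrite tie_drop0; split; lra.
have Jy : 0 < j.+1%:R - y j by rewrite subr_gt0 tie_drop_lt.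
rewrite tie_dropS -[j.+2%:R]natr1.
set J : R := j.+1%:R in IHz Jy *; set yj := y j in IH0 IHz IH1 Jy *.
have J1 : 1 <= J by rewrite /J ler1n.
clearbody J yj; split.
- have : 0 <= (1 - z) * (yj * J / (J - yj)).
    by rewrite mulr_ge0 ?divr_ge0 ?mulr_ge0 ?(ltW Jy) //; lra.
  lra.
- suff : (1 - z) * (yj * J / (J - yj)) <= J * (z / 2) by lra.
  rewrite [leLHS]mulrA ler_pdivrMr //.
  have : yj * (1 - z / 2) <= (1 - z / 2) * J * (z / 2) by nra.
  nra.
(* While z (J + 1) <= 2 the linear bound already gives at most 1; afterwards y_j <= 1 implies the
   same for the next index. *)
- have [zJ|zJ] := lerP (z * (J + 1)) 2.
    suff : (1 - z) * (yj * J / (J - yj)) <= J * (z / 2) by nra.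
    rewrite [leLHS]mulrA ler_pdivrMr //.
    nra.
  suff : (1 - z) * (yj * J / (J - yj)) <= 1 - z / 2 by lra.
  rewrite [leLHS]mulrA ler_pdivrMr //.
  have : yj * ((1 - z) * J + (1 - z / 2)) <= (1 - z) * J + (1 - z / 2).
    by rewrite ler_piMl // addr_ge0 ?mulr_ge0 //; lra.
  nra.
Qed.

(** The deviation from the limit 1/2 contracts by the factor 1 - z and receives a nonnegative source
    of order at most 1 / j; the two balance at order 1 / (z j). *)
Lemma tie_drop_excess j :
  y j.+1 - 2^-1 = (1 - z) * (y j - 2^-1 + y j ^+ 2 / (j.+1%:R - y j)).
Proof.
have Jy : j.+1%:R - y j != 0 by rewrite gt_eqF // subr_gt0 tie_drop_lt.
rewrite tie_dropS; move: (y j) (j.+1%:R : R) Jy => b J Jb.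
by field; rewrite Jb.
Qed.

(** Dropping the source in [tie_drop_excess] leaves a geometric decay of the initial deficit (1 - z)
    / 2. *)
Lemma tie_drop_ge j : 2^-1 - (1 - z) ^+ j.+1 / 2 <= y j.
Proof.
case/andP: z01 => z0 z1.
elim: j => [|j IH]; first by rewrite tie_drop0 expr1; lra.
have := tie_drop_excess j => H.
have Jy : 0 < j.+1%:R - y j by rewrite subr_gt0 tie_drop_lt.
have : (1 - z) * (y j - 2^-1) <= y j.+1 - 2^-1.
  by rewrite H ler_wpM2l ?subr_ge0 // lerDl divr_ge0 ?sqr_ge0 // ltW.
rewrite exprS; set a := _ ^+ _ in IH *; nra.
Qed.

(** A barrier argument: the bound follows from y <= 1 as long as the added term is at least 1/2, and
    after that the added term is a supersolution of [tie_drop_excess]. *)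
Lemma tie_drop_le j : y j <= 2^-1 + 6 / (z * j.+1%:R).
Proof.
case/andP: z01 => z0 z1.
elim: j => [|j IH].
  rewrite tie_drop0 mulr1.
  have : 6 <= 6 / z by rewrite ler_pdivlMr //; lra.
  lra.
have [_ _ y1] := tie_drop_bounds j; have [_ _ yS1] := tie_drop_bounds j.+1.
have [yj0 _ _] := tie_drop_bounds j.
have Jy : 0 < j.+1%:R - y j by rewrite subr_gt0 tie_drop_lt.
rewrite -[j.+2%:R]natr1; have := tie_drop_excess j.
set J : R := j.+1%:R in IH Jy *; set yj := y j in IH y1 yj0 Jy *.
have J1 : 1 <= J by rewrite /J ler1n.
have zJ1 : 0 < z * (J + 1) by rewrite mulr_gt0 //; lra.
have [zJ|zJ] := lerP (z * (J + 1)) 12.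
  have : 2^-1 <= 6 / (z * (J + 1)) by rewrite ler_pdivlMr //; lra.
  lra.
move=> H; suff : y j.+1 - 2^-1 <= 6 / (z * (J + 1)) by lra.
have J11 : 11 < J by nra.
have s1 : yj ^+ 2 / (J - yj) <= 1 / (J - 1).
  have yy : yj ^+ 2 <= 1 by rewrite exprn_ile1.
  rewrite ler_pdivrMr // mulrAC ler_pdivlMr; last lra.
  have : 0 <= (1 - yj ^+ 2) * (J - 1) by rewrite mulr_ge0 //; lra.
  lra.
have s2 : (1 - z) * (6 / (z * J) + 1 / (J - 1)) <= 6 / (z * (J + 1)).
  have -> : (1 - z) * (6 / (z * J) + 1 / (J - 1)) =
    ((1 - z) * (6 * (J - 1) + z * J)) / (z * J * (J - 1)).
    by field; rewrite !gt_eqF //; lra.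
  rewrite ler_pdivrMr; last by rewrite !mulr_gt0 //; lra.
  rewrite mulrAC ler_pdivlMr //.
  have : 0 <= z * z * J by rewrite !mulr_ge0 //; lra.
  nra.
rewrite H; apply: le_trans s2; rewrite ler_wpM2l ?subr_ge0 //.
by rewrite lerD // lerBlDl.
Qed.

Lemma tie_drop_ge_refined j : z <= 2^-1 ->
  2^-1 + 1 / (32 * (z * j.+1%:R)) - 3 / (z * j.+1%:R) ^+ 2 <= y j.
Proof.
case/andP: z01 => z0 _ z2.
(* A lower barrier. Its quadratic correction makes it at most -1/2 for t <= 2, where y >= 0 is
   enough; beyond that it is a subsolution of [tie_drop_excess]. *)
pose phi (t : R) : R := 1 / (32 * t) - 3 / t ^+ 2.
have phi_small t : 0 < t -> t <= 2 -> phi t <= - 2^-1.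
  move=> t0 t2; rewrite /phi.
  have -> : 1 / (32 * t) - 3 / t ^+ 2 = (t - 96) / (32 * t ^+ 2).
    by field; rewrite gt_eqF.
  rewrite ler_pdivrMr; last by rewrite mulr_gt0 ?exprn_gt0.
  have : t ^+ 2 <= 2 * 2 by rewrite expr2 ler_pM // ltW.
  lra.
suff : phi (z * j.+1%:R) <= y j - 2^-1 by rewrite lerBrDl addrA.
elim: j => [|j IH].
  rewrite mulr1; apply: (le_trans (phi_small _ z0 _)); last by rewrite tie_drop0; lra.
  lra.
have [y0 _ _] := tie_drop_bounds j; have [yS0 _ _] := tie_drop_bounds j.+1.
have Jy : 0 < j.+1%:R - y j by rewrite subr_gt0 tie_drop_lt.
have yge := tie_drop_ge j.
rewrite tie_drop_excess -[j.+2%:R]natr1.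
have J1 : 1 <= j.+1%:R :> R by rewrite ler1n.
(* Bernoulli's inequality bounds the geometric term by 1 / (1 + z J), hence by 2/5 once z J >= 3/2.
   Then y_j >= 3/10, and the source in [tie_drop_excess] is at least 1 / (16 J). *)
have pow : (1 - z) ^+ j.+1 * (1 + z * j.+1%:R) <= 1.
  have : (1 - z) ^+ j.+1 * (1 + z) ^+ j.+1 <= 1.
    by rewrite -exprMn exprn_ile1 //; nra.
  apply: le_trans; rewrite ler_wpM2l ?exprn_ge0 //; first lra.
  elim: (j) => [|i IHi]; first by rewrite mulr1 expr1.
  rewrite exprS -[i.+2%:R]natr1.
  apply: (@le_trans _ _ ((1 + z) * (1 + z * i.+1%:R))); last first.
    by rewrite ler_wpM2l //; lra.
  have : 0 <= i.+1%:R :> R by [].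
  nra.
set J : R := j.+1%:R in IH Jy pow J1 *; set yj := y j in IH y0 Jy yge *.
set a := _ ^+ j.+1 in yge pow.
have [zJ|zJ] := lerP (z * (J + 1)) 2.
  apply: (le_trans (phi_small _ _ zJ)); first by rewrite mulr_gt0 //; lra.
  by have := tie_drop_excess j; rewrite -/yj -/J => <-; lra.
clearbody a yj J.
have zJ1 : 3 / 2 <= z * J by nra.
have a25 : a <= 2 / 5 by nra.
have yj3 : 3 / 10 <= yj by lra.
have step : z / (16 * (z * J)) <= yj ^+ 2 / (J - yj).
  have -> : z / (16 * (z * J)) = 1 / 16 / J by field; rewrite !gt_eqF //; lra.
  rewrite ler_pdivlMr // mulrAC ler_pdivrMr; last lra.
  have yy : 9 / 100 <= yj ^+ 2 by nra.
  have : 0 <= (yj ^+ 2 - 9 / 100) * J by rewrite mulr_ge0 //; lra.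
  lra.
set t := z * J in IH zJ1 step *; have -> : z * (J + 1) = t + z by rewrite /t; ring.
apply: (@le_trans _ _ ((1 - z) * (phi t + z / (16 * t)))); last first.
  by rewrite ler_wpM2l ?subr_ge0 //; lra.
have t0 : 0 < t by lra.
have tz0 : 0 < t + z by lra.
have tz2 : 2 <= t + z by rewrite /t; lra.
rewrite -subr_ge0 /phi.
(* The slack is z / t times a sum of nonnegative terms: z <= 1/2 makes (1 - z) / 16 at least 1/32,
   and t + z >= 2 handles the last term. *)
have -> : (1 - z) * (1 / (32 * t) - 3 / t ^+ 2 + z / (16 * t)) -
    (1 / (32 * (t + z)) - 3 / (t + z) ^+ 2) =
  z / t * ((1 - z) / 16 - 1 / 32 + 1 / (32 * (t + z)) +
    3 / t * (1 - (t + (t + z)) / (t + z) ^+ 2)).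
  by field; rewrite !gt_eqF.
rewrite mulr_ge0 ?divr_ge0 ?(ltW z0) ?(ltW t0) //.
have h1 : 0 <= 1 / (32 * (t + z)) by rewrite divr_ge0 // mulr_ge0 // ltW.
have h2 : 0 <= 3 / t * (1 - (t + (t + z)) / (t + z) ^+ 2).
  rewrite mulr_ge0 ?divr_ge0 ?(ltW t0) // subr_ge0 ler_pdivrMr ?exprn_gt0 //.
  by nra.
lra.
Qed.

(* j f_j^2 converges with relative error of order 1 / (z j).  Divided by
   1 + 48 / (z j) it is nondecreasing, and divided by 1 + 1 / (256 z j) it is
   nonincreasing when z is small. *)
Lemma nondecr_tie_prob_weighted k l : (k <= l)%N -> 48 <= z * k%:R ->
  k%:R ^+ 2 * f k ^+ 2 / (k%:R + 48 / z) <=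
  l%:R ^+ 2 * f l ^+ 2 / (l%:R + 48 / z).
Proof.
case/andP: z01 => z0 z1 kl zk.
elim: l kl => [|l IH]; first by rewrite leqn0 => /eqP ->.
rewrite leq_eqVlt => /predU1P[->//|]; rewrite ltnS => kl.
apply: (le_trans (IH kl)).
have zl : 48 <= z * l%:R by apply: (le_trans zk); rewrite ler_pM2l // ler_nat.
have yle := tie_drop_le l; have [y0 _ y1] := tie_drop_bounds l.
have := f_gt0 l; rewrite tie_probS -[l.+1%:R]natr1 in yle *.
move: (l%:R : R) (y l) (f l) zl yle y0 y1 => L yl fl zl yle y0 y1 fl0.
have Md : z * (48 / z) = 48 by field; rewrite gt_eqF.
(* With M = 48 / z, [tie_drop_le] reads (y - 1/2) (L + 1) <= M / 8; the factor 8 is the room needed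
   in [key]. *)
have yM : 6 / (z * (L + 1)) * (L + 1) = 48 / z / 8.
  by field; rewrite !gt_eqF //; nra.
move: (48 / z) Md yM => M zM yM.
have M48 : 48 <= M by nra.
have LM : M <= L by rewrite -(ler_pM2l z0) zM.
have {}yle : (yl - 2^-1) * (L + 1) <= M / 8.
  rewrite -yM ler_wpM2r //; lra.
have -> : (L + 1) ^+ 2 * (fl * (1 - yl / (L + 1))) ^+ 2 = fl ^+ 2 * (L + 1 - yl) ^+ 2.
  by field; rewrite gt_eqF //; lra.
rewrite [L ^+ 2 * _]mulrC -!(mulrA (fl ^+ 2)) ler_wpM2l ?sqr_ge0 //.
rewrite ler_pdivrMr; last lra.
rewrite mulrAC ler_pdivlMr; last lra.
(* With d = y - 1/2, the bracket is the cost of d in (L + 1 - y)^2 = (L + 1/2)^2 - (2 d (L + 1/2) -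
   d^2). *)
have key : (2 * (yl - 2^-1) * (L + 2^-1) - (yl - 2^-1) ^+ 2) * (L + M) <=
    M * (L + 1) / 2.
  have b1 : 2 * (yl - 2^-1) * (L + 2^-1) - (yl - 2^-1) ^+ 2 <= M / 4.
    have [yl2|yl2] := lerP yl 2^-1.
      have : (yl - 2^-1) * (L + 2^-1) <= 0 by rewrite mulr_le0_ge0 //; lra.
      have := sqr_ge0 (yl - 2^-1); lra.
    have := sqr_ge0 (yl - 2^-1); lra.
  have : 0 <= (M / 4 - (2 * (yl - 2^-1) * (L + 2^-1) - (yl - 2^-1) ^+ 2)) * (L + M).
    by rewrite mulr_ge0 //; lra.
  have : 0 <= M * (L - M) by rewrite mulr_ge0 //; lra.
  lra.
have : 0 <= (M - 48) * (L + 1) by rewrite mulr_ge0 //; lra.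
have : 0 <= M * (L - M) by rewrite mulr_ge0 //; lra.
lra.
Qed.

Lemma nonincr_tie_prob_weighted k l : (k <= l)%N -> z <= 1 / 64 ->
  192 <= z * k%:R ->
  l%:R ^+ 2 * f l ^+ 2 / (l%:R + 1 / (256 * z)) <=
  k%:R ^+ 2 * f k ^+ 2 / (k%:R + 1 / (256 * z)).
Proof.
case/andP: z01 => z0 _ kl z64 zk.
elim: l kl => [|l IH]; first by rewrite leqn0 => /eqP ->.
rewrite leq_eqVlt => /predU1P[->//|]; rewrite ltnS => kl.
apply: le_trans (IH kl).
have zl : 192 <= z * l%:R by apply: (le_trans zk); rewrite ler_pM2l // ler_nat.
have z2 : z <= 2^-1 by lra.
have yge := tie_drop_ge_refined l z2; have [y0 _ y1] := tie_drop_bounds l.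
have := f_gt0 l; rewrite tie_probS -[l.+1%:R]natr1 in yge *.
move: (l%:R : R) (y l) (f l) zl yge y0 y1 => L yl fl zl yge y0 y1 fl0.
have L1 : 1 <= L by nra.
have zM : z * (1 / (256 * z)) = 1 / 256 by field; rewrite gt_eqF.
have yM : 1 / (64 * (z * (L + 1))) * (L + 1) = 4 * (1 / (256 * z)).
  by field; rewrite !gt_eqF //; nra.
move: (1 / (256 * z)) zM yM => M zM yM.
have M4 : 1 / 4 <= M by nra.
(* From z (L + 1) >= 192 on, the quadratic correction in [tie_drop_ge_refined] takes at most half of
   the main term; what remains, times L + 1, is 1 / (64 z) = 4 M. *)
clear zM; have {yge}yM4 : 4 * M <= (yl - 2^-1) * (L + 1).
  rewrite -yM ler_wpM2r //; first lra.
  suff : 1 / (64 * (z * (L + 1))) <= 1 / (32 * (z * (L + 1))) - 3 / (z * (L + 1)) ^+ 2 by lra.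
  have : 192 <= z * (L + 1) by lra.
  clear; move: (z * (L + 1)) => t t192; have t0 : 0 < t by lra.
  rewrite -subr_ge0.
  have -> : 1 / (32 * t) - 3 / t ^+ 2 - 1 / (64 * t) = (t - 192) / (64 * t ^+ 2).
    by field; rewrite gt_eqF.
  apply: divr_ge0; first by rewrite subr_ge0.
  by rewrite mulr_ge0 ?sqr_ge0.
have -> : (L + 1) ^+ 2 * (fl * (1 - yl / (L + 1))) ^+ 2 = fl ^+ 2 * (L + 1 - yl) ^+ 2.
  by field; rewrite gt_eqF //; lra.
rewrite [L ^+ 2 * _]mulrC -!(mulrA (fl ^+ 2)) ler_wpM2l ?sqr_ge0 //.
rewrite ler_pdivrMr; last lra.
rewrite mulrAC ler_pdivlMr; last lra.

clear zl zk yM z64 IH kl.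
have yl2 : 2^-1 <= yl by nra.
have key : 2 * M * (L + 1) <=
   (2 * (yl - 2^-1) * (L + 2^-1) - (yl - 2^-1) ^+ 2) * (L + M).
  have d4 : (yl - 2^-1) ^+ 2 <= 1 / 4 by nra.
  have b1 : 5 * M <= 2 * (yl - 2^-1) * (L + 2^-1) - (yl - 2^-1) ^+ 2 by lra.
  have : 0 <= (2 * (yl - 2^-1) * (L + 2^-1) - (yl - 2^-1) ^+ 2 - 5 * M) * (L + M).
    by rewrite mulr_ge0 //; lra.
  have : 0 <= M * L by rewrite mulr_ge0 //; lra.
  have : 0 <= M * M by rewrite mulr_ge0 //; lra.
  have : 0 <= M * (L - 1) by rewrite mulr_ge0 //; lra.
  lra.
have : 0 <= (M - 1 / 4) * (L + 1) by rewrite mulr_ge0 //; lra.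
lra.
Qed.

End TieProbBounds.

(** * Elementary inequalities for products of tie probabilities *)

(** From (1 - z)^n <= exp (- z n) and t exp (- t) <= 1. It turns the parity term (1 - z)^N into an
    error of order 1 / (z N). *)
Lemma exprn1B_mul_le1 (R : realType) (z : R) n : 0 < z <= 1 -> (1 - z) ^+ n * (z * n%:R) <= 1.
Proof.
case/andP => z0 z1.
have H : (1 - z) ^+ n <= expR (- (z * n%:R)).
  rewrite -mulNr expRM_natr lerXn2r ?nnegrE ?expR_ge0 ?subr_ge0 //.
  exact: expR_ge1Dx.
have n0 : 0 <= z * n%:R by rewrite mulr_ge0 // ltW.
apply: le_trans (ler_wpM2r n0 H) _.
rewrite expRN mulrC ler_pdivrMr ?expR_gt0 // mul1r.
by have := expR_ge1Dx (z * n%:R); lra.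
Qed.

(* [1 / (1 - x) = 1 + x / (1 - x)] *)
Lemma inv1B_le_expR (R : realType) (x : R) : 0 <= x <= 2^-1 -> (1 - x)^-1 <= expR (2 * x).
Proof.
case/andP => x0 x2; apply: le_trans (expR_ge1Dx _).
rewrite -[leLHS]mul1r ler_pdivrMr; last lra.
have : 0 <= x * (1 - 2 * x) by rewrite mulr_ge0 //; lra.
lra.
Qed.

(** Each hypothesis gives a^2 <= c^2 (N / K) exp (M / K), with N = K + L. In the product, N^2 / (K
    L) = 4 / (1 - s) for s = ((K - L) / N)^2, and 1 / (1 - s) <= exp (2 s). That K and L are at
    least N / 4 ensures s <= 1/4 and M / K + M / L <= 8 M / N. *)
Lemma tie_product_le (R : realType) (K L M a b c : R) : 0 < K -> 0 < L -> 0 < M ->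
  0 < a -> 0 < b -> 0 < c -> 
  K + L <= 4 * K -> K + L <= 4 * L ->
  K ^+ 2 * a ^+ 2 / (K + M) <= (K + L) ^+ 2 * c ^+ 2 / (K + L + M) ->
  L ^+ 2 * b ^+ 2 / (L + M) <= (K + L) ^+ 2 * c ^+ 2 / (K + L + M) ->
  a * b / (2 * c ^+ 2) <= expR ((K - L) ^+ 2 / (K + L) ^+ 2 + 4 * M / (K + L)).
Proof.
move=> K0 L0 M0 a0 b0 c0 K4 L4.
set N := K + L; have N0 : 0 < N by rewrite addr_gt0.
have half (J x : R) : 0 < J -> J ^+ 2 * x ^+ 2 / (J + M) <= N ^+ 2 * c ^+ 2 / (N + M) ->
    x ^+ 2 <= c ^+ 2 * (N / J) * expR (M / J).
  move=> J0 H.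
  have H1 : N ^+ 2 * c ^+ 2 / (N + M) <= N * c ^+ 2.
    rewrite ler_pdivrMr; last by rewrite addr_gt0.
    have : 0 <= N * c ^+ 2 * M by rewrite !mulr_ge0 ?sqr_ge0 // ltW.
    lra.
  have H2 : x ^+ 2 <= c ^+ 2 * (N / J) * (1 + M / J).
    have -> : c ^+ 2 * (N / J) * (1 + M / J) = N * c ^+ 2 * (J + M) / J ^+ 2.
      by field; rewrite gt_eqF.
    rewrite ler_pdivlMr ?exprn_gt0 // mulrC.
    by rewrite -ler_pdivrMr ?addr_gt0 //; apply: le_trans H1.
  apply: (le_trans H2); rewrite ler_wpM2l ?expR_ge1Dx //.
  by rewrite mulr_ge0 ?sqr_ge0 //; apply/ltW/divr_gt0.
move=> /(half K a K0) ha /(half L b L0) hb.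
have := ler_pM (sqr_ge0 _) (sqr_ge0 _) ha hb => hab.
set u := _ + 4 * M / N.
rewrite -(@ler_pXn2r _ 2) ?nnegrE ?expR_ge0 //; last first.
  by rewrite divr_ge0 ?mulr_ge0 ?sqr_ge0 // ltW.
rewrite -expRM_natl exprMn exprMn exprVn ler_pdivrMr ?exprn_gt0 ?mulr_gt0 ?exprn_gt0 //.
apply: (le_trans hab).
pose s := (K - L) ^+ 2 / N ^+ 2.
have s4 : 0 <= s <= 1 / 4.
  rewrite divr_ge0 ?sqr_ge0 //= ler_pdivrMr ?exprn_gt0 // /N.
  nra.
have KL : N / K * (N / L) = 4 * (1 - s)^-1.
  rewrite /s /N; field; rewrite !gt_eqF //.
  by rewrite (_ : _ - _ = 4 * (K * L)) ?mulr_gt0 //; ring.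
have MM : expR (M / K) * expR (M / L) <= expR (8 * M / N).
  rewrite -expRD ler_expR.
  have h (J : R) : 0 < J -> N <= 4 * J -> M / J <= 4 * M / N.
    move=> J0 NJ; rewrite ler_pdivrMr // mulrAC ler_pdivlMr //.
    have : 0 <= M * (4 * J - N) by rewrite mulr_ge0 ?subr_ge0 // ltW.
    lra.
  have := h _ K0 K4; have := h _ L0 L4; lra.
have -> : c ^+ 2 * (N / K) * expR (M / K) * (c ^+ 2 * (N / L) * expR (M / L)) =
    c ^+ 4 * (N / K * (N / L)) * (expR (M / K) * expR (M / L)) by ring.
have s4' : 0 <= s <= 2^-1 by lra.
rewrite KL; have := inv1B_le_expR s4' => hs.
apply: (@le_trans _ _ (c ^+ 4 * (4 * expR (2 * s)) * expR (8 * M / N))).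
  have c4 : 0 <= c ^+ 4 by rewrite exprn_ge0 // ltW.
  have s1 : 0 <= (1 - s)^-1 by rewrite invr_ge0; lra.
  have m0 : 0 <= c ^+ 4 * (4 * (1 - s)^-1) by rewrite mulr_ge0 // mulr_ge0.
  apply: (ler_pM m0 _ _ MM); first by rewrite mulr_ge0 ?expR_ge0.
  by apply: ler_wpM2l => //; apply: ler_wpM2l.
have -> : 2 * u = 2 * s + 8 * M / N by rewrite /u /s; field; rewrite gt_eqF.
rewrite expRD le_eqVlt; apply/orP; left; apply/eqP; ring.
Qed.

(** For fixed N = K + L the resulting lower bound on a b is smallest at K = L, where it equals 2 c^2
    r with r = 1 + M / (N + M); and r >= exp (M / (4 N)) because M <= N. *)
Lemma tie_product_ge (R : realType) (K L M a b c : R) : 0 < K -> 0 < L -> 0 < M ->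
  0 < a -> 0 < b -> 0 < c -> M <= K + L ->
  (K + L) ^+ 2 * c ^+ 2 / (K + L + M) <= K ^+ 2 * a ^+ 2 / (K + M) ->
  (K + L) ^+ 2 * c ^+ 2 / (K + L + M) <= L ^+ 2 * b ^+ 2 / (L + M) ->
  expR (M / (4 * (K + L))) <= a * b / (2 * c ^+ 2).
Proof.
move=> K0 L0 M0 a0 b0 c0.
set N := K + L; have N0 : 0 < N by rewrite addr_gt0.
move=> MN.
have half (J x : R) : 0 < J -> N ^+ 2 * c ^+ 2 / (N + M) <= J ^+ 2 * x ^+ 2 / (J + M) ->
    c ^+ 2 * (N ^+ 2 / (N + M) * (J + M) / J ^+ 2) <= x ^+ 2.
  move=> J0; rewrite ler_pdivlMr ?addr_gt0 // => H.
  rewrite !mulrA ler_pdivrMr ?exprn_gt0 //; lra.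
move=> /(half K a K0) ha /(half L b L0) hb.
have g0 (J : R) : 0 < J -> 0 <= c ^+ 2 * (N ^+ 2 / (N + M) * (J + M) / J ^+ 2).
  move=> J0; rewrite mulr_ge0 ?sqr_ge0 // divr_ge0 ?sqr_ge0 // mulr_ge0 //.
    by rewrite divr_ge0 ?sqr_ge0 // ltW ?addr_gt0.
  by rewrite ltW ?addr_gt0.
have := ler_pM (g0 _ K0) (g0 _ L0) ha hb => hab.
pose r := 1 + M / (N + M).
apply: (@le_trans _ _ r).
  have h1 : expR (M / (4 * N)) <= (1 - M / (4 * N))^-1.
    rewrite -[leLHS]invrK -expRN lef_pV2 ?posrE ?expR_gt0 ?expR_ge1Dx //.
    rewrite subr_gt0 ltr_pdivrMr ?mulr_gt0 //; lra.
  apply: (le_trans h1); rewrite -[leLHS]mul1r ler_pdivrMr; last first.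
    by rewrite subr_gt0 ltr_pdivrMr ?mulr_gt0 //; lra.
  rewrite -subr_ge0 /r.
  have -> : (1 + M / (N + M)) * (1 - M / (4 * N)) - 1 = 
     M * (3 * N - 2 * M) / (4 * N * (N + M)).
    by field; rewrite !gt_eqF ?addr_gt0.
  rewrite divr_ge0 // !mulr_ge0 //; try lra.
rewrite ler_pdivlMr ?mulr_gt0 ?exprn_gt0 //.
have r0 : 0 <= r by rewrite addr_ge0 // divr_ge0 // ltW ?addr_gt0.
rewrite -(@ler_pXn2r _ 2) ?nnegrE ?mulr_ge0 ?sqr_ge0 ?(ltW a0) ?(ltW b0) ?(ltW c0) //.
rewrite [leRHS]exprMn; apply: le_trans hab.
have -> : c ^+ 2 * (N ^+ 2 / (N + M) * (K + M) / K ^+ 2) *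
   (c ^+ 2 * (N ^+ 2 / (N + M) * (L + M) / L ^+ 2)) =
   c ^+ 4 * ((N ^+ 2 / (N + M)) ^+ 2 * ((K + M) * (L + M) / (K * L) ^+ 2)).
  by field; rewrite !gt_eqF ?addr_gt0.
have -> : (r * (2 * c ^+ 2)) ^+ 2 = c ^+ 4 * (4 * r ^+ 2) by ring.
rewrite ler_wpM2l ?exprn_ge0 ?(ltW c0) //.
have -> : 4 * r ^+ 2 = (N ^+ 2 / (N + M)) ^+ 2 * (4 * (N + 2 * M) ^+ 2 / (N ^+ 2) ^+ 2).
  by rewrite /r; field; rewrite !gt_eqF ?addr_gt0.
rewrite ler_wpM2l ?sqr_ge0 //.
have -> : (K + M) * (L + M) = K * L + M * N + M ^+ 2 by rewrite /N; ring.
have P4 : 4 * (K * L) <= N ^+ 2 by rewrite /N; have := sqr_ge0 (K - L); lra.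
have P0 : 0 < K * L by rewrite mulr_gt0.
move: (K * L) P4 P0 => P P4 P0.
rewrite ler_pdivrMr ?exprn_gt0 //.
rewrite mulrAC ler_pdivlMr ?exprn_gt0 //.
rewrite -subr_ge0.
(* The difference vanishes at K = L, that is at P = N^2 / 4, so N^2 - 4 P factors out. *)
have -> : (P + M * N + M ^+ 2) * (N ^+ 2) ^+ 2 - 4 * (N + 2 * M) ^+ 2 * P ^+ 2 =
   (N ^+ 2 - 4 * P) * (P * N ^+ 2 + (M * N + M ^+ 2) * (N ^+ 2 + 4 * P)) by ring.
rewrite mulr_ge0 ?subr_ge0 //.
by rewrite !(addr_ge0, mulr_ge0) ?exprn_ge0 // ltW.
Qed.

(** * Bounds on the factor that one row contributes at a given overlap *)

Section OverlapFactor.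
Variables (R : realType) (z : R).
Hypothesis z01 : 0 < z <= 1.

Local Notation f := (tie_prob z).

Let f_gt0 j : 0 < f j.
Proof. by case/andP: z01 => z0 z1; rewrite tie_prob_gt0 // (ltW z0). Qed.

(* [(1 + (1 - z)^(k + l)) / 2] is the probability that a row of length
   2 (k + l) has an even sum. *)
Definition overlap_factor (k l : nat) : R :=
  (1 + (1 - z) ^+ (k + l)) / 2 * (f k * f l) / f (k + l) ^+ 2.

Lemma overlap_factor_ge0 k l : 0 <= overlap_factor k l.
Proof.
case/andP: z01 => z0 z1.
rewrite /overlap_factor divr_ge0 ?sqr_ge0 // mulr_ge0 //; last by rewrite mulr_ge0 ?ltW.
by rewrite divr_ge0 // addr_ge0 // exprn_ge0 // subr_ge0.
Qed.

Lemma tie_prob_le1 j : f j <= 1.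
Proof.
elim: j => [|j IH]; first by rewrite tie_prob0.
have [y0 _ _] := tie_drop_bounds z01 j.
rewrite (tie_probS z01); apply: le_trans IH; rewrite ler_piMr ?(ltW (f_gt0 j)) //.
by rewrite lerBlDr lerDl divr_ge0.
Qed.

(** The sequence j f_j is nondecreasing because [tie_drop] is at most 1, and it starts at 1 - z /
    2. *)
Lemma tie_prob_ge j : (0 < j)%N -> 2^-1 <= j%:R * f j.
Proof.
case/andP: z01 => z0 z1.
elim: j => // -[_ _|j IH _].
  by rewrite (tie_probS z01) tie_prob0 tie_drop0 !mul1r divr1; lra.
apply: (le_trans (IH _)) => //.
have [_ _ y1] := tie_drop_bounds z01 j.+1.
rewrite (tie_probS z01 j.+1) -[j.+2%:R]natr1.
have := f_gt0 j.+1; have : 0 < j.+1%:R :> R by [].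
move: (j.+1%:R : R) (f j.+1) (tie_drop z j.+1) y1 => J a y y1 J0 a0.
have -> : (J + 1) * (a * (1 - y / (J + 1))) = J * a + a * (1 - y).
  by field; rewrite gt_eqF //; lra.
by rewrite lerDl mulr_ge0 ?subr_ge0 // ltW.
Qed.

Lemma overlap_factor_crude k l : (0 < k + l)%N ->
  overlap_factor k l <= (2 * (k + l)%:R) ^+ 2.
Proof.
move=> kl; case/andP: z01 => z0 z1.
have := tie_prob_ge kl; have := f_gt0 (k + l); rewrite /overlap_factor.
have : (1 + (1 - z) ^+ (k + l)) / 2 * (f k * f l) <= 1.
  rewrite -[leRHS]mulr1 ler_pM ?mulr_ge0 ?(ltW (f_gt0 _)) //.
  - by rewrite addr_ge0 // exprn_ge0 // subr_ge0.
  - have : (1 - z) ^+ (k + l) <= 1 by rewrite exprn_ile1 //; lra.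
    lra.
  - by rewrite -[leRHS]mulr1 ler_pM ?(ltW (f_gt0 _)) ?tie_prob_le1.
move: (_ * (f k * f l)) (f (k + l)) ((k + l)%:R : R) => a b N a1 b0 Nb.
rewrite ler_pdivrMr ?exprn_gt0 //.
apply: (le_trans a1); rewrite -exprMn.
by rewrite -[leLHS](expr1n _ 2) lerXn2r ?nnegrE //; lra.
Qed.

(** [tie_product_le] with M = 48 / z: the constant 193 is 4 * 48, plus 1 for the parity term, and
    192 = 4 * 48 because k and l are at least a quarter of k + l. *)
Lemma overlap_factor_le k l : (k + l <= 4 * k)%N -> (k + l <= 4 * l)%N ->
  192 <= z * (k + l)%:R ->
  overlap_factor k l <=
  expR ((k%:R - l%:R) ^+ 2 / (k + l)%:R ^+ 2 + 193 / (z * (k + l)%:R)).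
Proof.
move=> k4 l4 zN; case/andP: z01 => z0 z1.
have zk : 48 <= z * k%:R.
  have : z * (k + l)%:R <= z * (4 * k)%:R by rewrite ler_pM2l // ler_nat.
  rewrite natrM; lra.
have zl : 48 <= z * l%:R.
  have : z * (k + l)%:R <= z * (4 * l)%:R by rewrite ler_pM2l // ler_nat.
  rewrite natrM; lra.
have fk := nondecr_tie_prob_weighted z01 (leq_addr l k) zk.
have fl := nondecr_tie_prob_weighted z01 (leq_addl k l) zl.
have N0 : 0 < (k + l)%:R :> R.
  by rewrite lt_neqAle ler0n andbT; apply/eqP => e; move: zN; rewrite -e; lra.
have pow : 1 + (1 - z) ^+ (k + l) <= expR (1 / (z * (k + l)%:R)).
  apply: le_trans (expR_ge1Dx _); rewrite lerD2l ler_pdivlMr ?mulr_gt0 //.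
  exact: (exprn1B_mul_le1 (k + l) z01).
have k0 : 0 < k%:R :> R by rewrite -(pmulr_rgt0 _ z0); lra.
have l0 : 0 < l%:R :> R by rewrite -(pmulr_rgt0 _ z0); lra.
have M0 : 0 < 48 / z by rewrite divr_gt0.
have kN : k%:R + l%:R <= 4 * k%:R :> R by rewrite -natrD -natrM ler_nat.
have lN : k%:R + l%:R <= 4 * l%:R :> R by rewrite -natrD -natrM ler_nat.
move: fk fl; rewrite natrD => fk fl.
have := tie_product_le k0 l0 M0 (f_gt0 k) (f_gt0 l) (f_gt0 (k + l)) kN lN fk fl.
rewrite -natrD => H.
have -> : (k%:R - l%:R) ^+ 2 / (k + l)%:R ^+ 2 + 193 / (z * (k + l)%:R) =
  1 / (z * (k + l)%:R) + ((k%:R - l%:R) ^+ 2 / (k + l)%:R ^+ 2 + 4 * (48 / z) / (k + l)%:R) :> R.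
  move: (k%:R : R) (l%:R : R) ((k + l)%:R : R) N0 => K L N N0.
  by field; rewrite !gt_eqF.
have -> : overlap_factor k l =
    (1 + (1 - z) ^+ (k + l)) * (f k * f l / (2 * f (k + l) ^+ 2)).
  rewrite /overlap_factor; move: (f_gt0 (k + l)) => c0.
  move: (f k) (f l) (f (k + l)) (_ ^+ (k + l)) c0 => a b c e c0.
  by field; rewrite gt_eqF.
rewrite expRD ler_pM //; first by rewrite addr_ge0 // exprn_ge0 // subr_ge0.
by rewrite divr_ge0 ?mulr_ge0 ?sqr_ge0 // ltW // f_gt0.
Qed.

(** [tie_product_ge] with M = 1 / (256 z), the parity factor being bounded below by 1. *)
Lemma overlap_factor_ge k l : (k + l <= 4 * k)%N -> (k + l <= 4 * l)%N ->
  768 <= z * (k + l)%:R -> z <= 1 / 64 ->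
  expR (1 / (1024 * (z * (k + l)%:R))) <= overlap_factor k l.
Proof.
move=> k4 l4 zN z64; case/andP: z01 => z0 z1.
have zk : 192 <= z * k%:R.
  have : z * (k + l)%:R <= z * (4 * k)%:R by rewrite ler_pM2l // ler_nat.
  rewrite natrM; lra.
have zl : 192 <= z * l%:R.
  have : z * (k + l)%:R <= z * (4 * l)%:R by rewrite ler_pM2l // ler_nat.
  rewrite natrM; lra.
have fk := nonincr_tie_prob_weighted z01 (leq_addr l k) z64 zk.
have fl := nonincr_tie_prob_weighted z01 (leq_addl k l) z64 zl.
have k0 : 0 < k%:R :> R by rewrite -(pmulr_rgt0 _ z0); lra.
have l0 : 0 < l%:R :> R by rewrite -(pmulr_rgt0 _ z0); lra.
have z256 : 0 < 256 * z by rewrite (pmulr_lgt0 _ z0) ltr0n.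
have M0 : 0 < 1 / (256 * z) by rewrite div1r invr_gt0.
have MN : 1 / (256 * z) <= k%:R + l%:R.
  rewrite -natrD (ler_pdivrMr _ _ z256); lra.
move: fk fl; rewrite natrD => fk fl.
have := tie_product_ge k0 l0 M0 (f_gt0 k) (f_gt0 l) (f_gt0 (k + l)) MN fk fl.
rewrite -natrD => H.
have N0 : 0 < (k + l)%:R :> R by rewrite natrD addr_gt0.
have -> : 1 / (1024 * (z * (k + l)%:R)) = 1 / (256 * z) / (4 * (k + l)%:R) :> R.
  move: ((k + l)%:R : R) N0 => N N0.
  by field; rewrite !gt_eqF.
apply: (le_trans H).
have -> : overlap_factor k l =
    (1 + (1 - z) ^+ (k + l)) * (f k * f l / (2 * f (k + l) ^+ 2)).
  rewrite /overlap_factor; move: (f_gt0 (k + l)) => c0.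
  move: (f k) (f l) (f (k + l)) (_ ^+ (k + l)) c0 => a b c e c0.
  by field; rewrite gt_eqF.
rewrite ler_peMl ?lerDl ?exprn_ge0 ?subr_ge0 //.
by rewrite divr_ge0 ?mulr_ge0 ?sqr_ge0 // ltW // f_gt0.
Qed.

End OverlapFactor.

(** * The law of a single row and its tie events *)

Section RowLaw.
Variables (R : realType) (n : nat) (p : R).

Definition row_law (r : {ffun 'I_n -> bool}) : R :=
  \prod_j bernoulli_pmf p (r j).

(** Independence of the entries as a generating-function identity; the morphism [h] lets the weights
    live in a larger ring, such as one with formal variables. *)
Lemma sum_row_law_prod (S : comPzRingType) (h : {rmorphism R -> S})
    (w : 'I_n -> bool -> S) :
  \sum_r h (row_law r) * \prod_j w j (r j) =
  \prod_j (h p * w j true + h (1 - p) * w j false).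
Proof.
transitivity (\prod_(j < n) \sum_(b : bool) h (bernoulli_pmf p b) * w j b).
  rewrite bigA_distr_bigA /=; apply: eq_bigr => r _.
  by rewrite rmorph_prod -big_split.
by apply: eq_bigr => j _; rewrite big_bool.
Qed.

Definition row_even (r : {ffun 'I_n -> bool}) := ~~ odd (\sum_(j < n) r j).

Lemma sum_row_law_even : \sum_(r | row_even r) row_law r = (1 + (1 - 2 * p) ^+ n) / 2.
Proof.
have h1 := @sum_row_law_prod R idfun (fun _ _ => 1).
have h2 := @sum_row_law_prod R idfun (fun _ b => (-1) ^+ b).
rewrite big_mkcond /=.
transitivity (\sum_r (row_law r * \prod_(j < n) 1 + row_law r * \prod_(j < n) (-1) ^+ r j) / 2).
  (* The indicator of an even sum is (1 + (-1)^sum) / 2. *)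
  apply: eq_bigr => r _; rewrite -expr_sum big1 // mulr1 -signr_odd /row_even.
  by case: (odd _); rewrite ?expr0 ?expr1; field.
rewrite -mulr_suml big_split /= h1 h2 /=.
rewrite !prodr_const !card_ord (_ : p * 1 + (1 - p) * 1 = 1); last by ring.
by rewrite expr1n; congr ((1 + _ ^+ _) / 2); ring.
Qed.

(* Half of the signs of a balanced vector u are negative: with U the set of
   negative indices, r has the same number of ones on S :\: U and on S :&: U. *)
Definition tied (S U : {set 'I_n}) (r : {ffun 'I_n -> bool}) : bool :=
  (\sum_(j in S :\: U) r j == \sum_(j in S :&: U) r j)%N.

Let flip (U : {set 'I_n}) j (b : bool) : nat := (if j \in U then ~~ b else b)%N.

(** Complementing the bits on [U] turns an equality of two sums into one sum taking a prescribed
    value, which a coefficient of a generating function detects. *)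
Lemma tiedE (S U : {set 'I_n}) r :
  tied S U r = (\sum_(j in S) flip U j (r j) == #|S :&: U|)%N.
Proof.
rewrite /tied [in RHS](big_setID U) /=.
rewrite [X in (X + _)%N](eq_bigr (fun j => 1 - r j)%N); last first.
  by move=> j /setIP[_ jU]; rewrite /flip jU; case: (r j).
rewrite [X in (_ + X)%N](eq_bigr (fun j => r j : nat)); last first.
  by move=> j /setDP[_ /negbTE jU]; rewrite /flip jU.
rewrite sumnB; last by move=> j _; case: (r j).
have le : (\sum_(j in S :&: U) r j <= \sum_(j in S :&: U) 1)%N.
  by apply: leq_sum => j _; case: (r j).
rewrite -sum1_card; move: le.
move: (\sum_(j in S :&: U) r j)%N (\sum_(j in S :\: U) r j)%N (\sum_(j in S :&: U) 1)%N => a b c.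
lia.
Qed.

(** A bivariate generating function: the outer ['X] counts flipped bits on [S], the inner ['X%:P]
    those on its complement. It factors as F^k in one variable times F^l in the other, and
    [coef_tie_prob] gives the two coefficients. *)
Lemma sum_row_law_tied (S U : {set 'I_n}) k l :
  #|S :\: U| = k -> #|S :&: U| = k -> #|~: S :\: U| = l -> #|~: S :&: U| = l ->
  \sum_(r | tied S U r && tied (~: S) U r) row_law r =
  tie_prob (4 * p * (1 - p)) k * tie_prob (4 * p * (1 - p)) l.
Proof.
move=> cSD cSI cTD cTI.
pose F : {poly R} := ((1 - p)%:P + p *: 'X) * (p%:P + (1 - p) *: 'X).
pose h : {rmorphism R -> {poly {poly R}}} := (@polyC {poly R} \o @polyC R)%FUN.
pose v j : {poly {poly R}} := if j \in S then 'X else 'X%:P.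
have := sum_row_law_prod h (fun j b => v j ^+ flip U j b).
have prodE (w : 'I_n -> {poly {poly R}}) : \prod_j w j =
    (\prod_(j in S) w j) * \prod_(j in ~: S) w j.
  rewrite (bigID (mem S)) /=; congr (_ * _).
  by apply: eq_bigl => j; rewrite inE.
have vS j : j \in S -> v j = 'X by rewrite /v => ->.
have vC j : j \in ~: S -> v j = 'X%:P by rewrite inE /v => /negbTE ->.
have -> : \prod_j (h p * v j ^+ flip U j true + h (1 - p) * v j ^+ flip U j false) =
    map_poly polyC (F ^+ k) * (F ^+ l)%:P.
  have half (T : {set 'I_n}) x i : #|T :\: U| = i -> #|T :&: U| = i ->
      (forall j, j \in T -> v j = x) ->
      \prod_(j in T) (h p * v j ^+ flip U j true + h (1 - p) * v j ^+ flip U j false) =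
      ((h (1 - p) + h p * x) * (h p + h (1 - p) * x)) ^+ i.
    move=> cD cI vT; rewrite (big_setID U) /= exprMn mulrC; congr (_ * _).
      rewrite (eq_bigr (fun=> h (1 - p) + h p * x)) ?prodr_const ?cD // => j.
      by move=> /setDP[jT jU]; rewrite vT // /flip (negbTE jU) expr0 expr1 mulr1 addrC.
    rewrite (eq_bigr (fun=> h p + h (1 - p) * x)) ?prodr_const ?cI // => j.
    by move=> /setIP[jT jU]; rewrite vT // /flip jU expr0 expr1 mulr1.
  rewrite prodE (half S 'X k) // (half (~: S) 'X%:P l) //.
  rewrite rmorphXn polyC_exp; congr (_ ^+ _ * _ ^+ _).
    by rewrite /F -!mul_polyC !(rmorphM, rmorphD) /= !map_polyC map_polyX.
  by rewrite /F -!mul_polyC /h /= !(polyCM, polyCD).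
move=> H; have {H} := congr1 (fun P : {poly {poly R}} => P`_k`_l) H.
rewrite coefMC coef_map /= coefCM !coef_tie_prob => <-.
rewrite !coef_sum big_mkcond /=; apply: eq_bigr => r _.
rewrite prodE !tiedE cSI cTI.
have -> : \prod_(j in S) v j ^+ flip U j (r j) = 'X^(\sum_(j in S) flip U j (r j))%N.
  by rewrite expr_sum; apply: eq_bigr => j jS; rewrite vS.
have -> : \prod_(j in ~: S) v j ^+ flip U j (r j) =
    ('X^(\sum_(j in ~: S) flip U j (r j))%N)%:P.
  by rewrite polyC_exp expr_sum; apply: eq_bigr => j jS; rewrite vC.
rewrite /h /= mulrA coefMC coefCM coefXn.
move: (\sum_(j in S) _)%N (\sum_(j in ~: S) _)%N => a b.
rewrite [k == a]eq_sym; case: (a == k); last by rewrite mulr0 mul0r coef0.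
rewrite mulr1 coefCM coefXn [l == b]eq_sym.
by case: (b == l); rewrite ?mulr1 ?mulr0.
Qed.

End RowLaw.

(** * First and second moments of the number of solutions *)

Section Moments.
Variables (R : realType) (m n N : nat) (p : R).
Hypothesis nN : n = N.*2.

Definition row_fun (A : 'M[bool]_(m, n)) (i : 'I_m) : {ffun 'I_n -> bool} :=
  [ffun j => A i j].

Lemma sum_ensemble_rows (Q : pred {ffun 'I_n -> bool}) :
  \sum_(A : 'M[bool]_(m, n) | [forall i, Q (row_fun A i)])
     bernoulli_ensemble p A = (\sum_(r | Q r) row_law p r) ^+ m.
Proof.
pose mx (F : {ffun 'I_m -> {ffun 'I_n -> bool}}) : 'M[bool]_(m, n) :=
  \matrix_(i, j) F i j.
have mx_row F i : row_fun (mx F) i = F i by apply/ffunP => j; rewrite ffunE mxE.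
rewrite (reindex mx) /=; last first.
  exists (fun A => [ffun i => row_fun A i]) => [F _|A _].
    by apply/ffunP => i; rewrite ffunE mx_row.
  by apply/matrixP => i j; rewrite mxE !ffunE.
rewrite [in RHS]big_mkcond -[X in _ ^+ X]card_ord -prodr_const bigA_distr_bigA /=.
rewrite big_mkcond; apply: eq_bigr => F _.
under eq_forallb do rewrite mx_row.
case: ifP => [/forallP QF|/negbT].
  apply: eq_bigr => i _; rewrite QF; apply: eq_bigr => j _.
  by rewrite -mx_row ffunE.
rewrite negb_forall => /existsP[i /negbTE Qi].
by rewrite (bigD1 i) //= Qi mul0r.
Qed.

Lemma prob_even_rows :
  prob p (even_rows m n) = ((1 + (1 - 2 * p) ^+ n) / 2) ^+ m.
Proof.
rewrite -sum_row_law_even -sum_ensemble_rows /prob; apply: eq_bigl => A.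
rewrite inE; apply: eq_forallb => i; congr (~~ odd _).
by apply: eq_bigr => j _; rewrite ffunE.
Qed.

(** [U] is the set of negative indices of a sign vector, to which the row is orthogonal. *)
Definition zero_row (U : {set 'I_n}) (r : {ffun 'I_n -> bool}) : bool :=
  (\sum_(j in ~: U) r j == \sum_(j in U) r j)%N.

Lemma zero_row_even U r : zero_row U r -> row_even r.
Proof.
move=> /eqP e; rewrite /row_even.
have -> : (\sum_(j < n) r j = (\sum_(j in U) r j).*2)%N.
  rewrite (bigID (mem U)) /= [X in (_ + X)%N](_ : _ = \sum_(j in ~: U) r j)%N.
    by rewrite e addnn.
  by apply: eq_bigl => j; rewrite inE.
by rewrite odd_double.
Qed.

Lemma zero_row_tied U r : zero_row U r = tied [set: 'I_n]%SET U r && tied (~: [set: 'I_n]%SET) U r.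
Proof.
rewrite /tied finset.setTI finset.setTD finset.setCT finset.set0I finset.set0D.
by rewrite !big_set0 eqxx andbT.
Qed.

Let agree (U V : {set 'I_n}) : {set 'I_n} := [set j | (j \in U) == (j \in V)]%SET.

(** The sum and the difference of two sign vectors are supported where they agree and where they
    differ, so orthogonality to both means one tie on each of these two disjoint blocks. *)
Lemma zero_row2_tied U V r :
  zero_row U r && zero_row V r = tied (agree U V) U r && tied (~: agree U V) U r.
Proof.
rewrite /zero_row /tied.
pose a (B : {set 'I_n}) := (\sum_(j in B) r j)%N.
have split (B S : {set 'I_n}) : a B = (a (S :&: B) + a (~: S :&: B))%N.
  by rewrite /a (big_setID S) /= finset.setIC finset.setDE [B :&: ~: S]finset.setIC.
rewrite -!/(a _).
have -> : a (~: U) = (a (agree U V :\: U) + a (~: agree U V :\: U))%N.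
  by rewrite (split _ (agree U V)) !finset.setDE.
have -> : a U = (a (agree U V :&: U) + a (~: agree U V :&: U))%N.
  exact: split.
have -> : a (~: V) = (a (agree U V :\: U) + a (~: agree U V :&: U))%N.
  rewrite (split _ (agree U V)); congr (a _ + a _)%N; apply/finset.setP => j.
    by rewrite !inE; case: (j \in U); case: (j \in V).
  by rewrite !inE; case: (j \in U); case: (j \in V).
have -> : a V = (a (agree U V :&: U) + a (~: agree U V :\: U))%N.
  rewrite (split _ (agree U V)); congr (a _ + a _)%N; apply/finset.setP => j.
    by rewrite !inE; case: (j \in U); case: (j \in V).
  by rewrite !inE; case: (j \in U); case: (j \in V).
move: (a _) (a _) (a _) (a _) => x y w t; lia.
Qed.

Let z : R := 4 * p * (1 - p).

Lemma sum_zero_row (U : {set 'I_n}) : #|U| = N ->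
  \sum_(r | zero_row U r) row_law p r = tie_prob z N.
Proof.
move=> cU; rewrite (eq_bigl _ _ (zero_row_tied U)).
have cC : #|~: U| = N by rewrite cardsCs finset.setCK card_ord cU nN; lia.
rewrite (@sum_row_law_tied _ _ _ _ _ N 0) ?finset.setTI ?finset.setTD ?finset.setCT
  ?finset.set0I ?finset.set0D ?cards0 //.
by rewrite tie_prob0 mulr1.
Qed.

(** As both sets have size n / 2, the intersection and the complement of the union have equal size,
    and so do the two differences; this is the balance [sum_row_law_tied] asks for. *)
Lemma sum_zero_row2 (U V : {set 'I_n}) : #|U| = N -> #|V| = N ->
  \sum_(r | zero_row U r && zero_row V r) row_law p r =
  tie_prob z #|V :&: U| * tie_prob z (N - #|V :&: U|).
Proof.
move=> cU cV; rewrite (eq_bigl _ _ (zero_row2_tied U V)).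
have hU := cardsID V U; have hV := cardsID U V; have hUV := cardsU V U.
have hC : #|~: (V :|: U)| = (n - #|V :|: U|)%N by rewrite cardsCs finset.setCK card_ord.
have hs : (#|V :|: U| <= n)%N by rewrite -[X in (_ <= X)%N]card_ord max_card.
have le : (#|V :&: U| <= #|V|)%N by rewrite subset_leq_card ?finset.subsetIl.
rewrite finset.setIC in hU.
apply: sum_row_law_tied.
- rewrite (_ : _ :\: _ = ~: (V :|: U)); first by lia.
  by apply/finset.setP => j; rewrite !inE; case: (j \in U); case: (j \in V).
- congr #|pred_of_set _|.
  by apply/finset.setP => j; rewrite !inE; case: (j \in U); case: (j \in V).
- rewrite (_ : _ :\: _ = V :\: U); first by lia.
  by apply/finset.setP => j; rewrite !inE; case: (j \in U); case: (j \in V).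
- rewrite (_ : _ :&: _ = U :\: V); first by lia.
  by apply/finset.setP => j; rewrite !inE; case: (j \in U); case: (j \in V).
Qed.

Lemma Z0_sum (A : 'M[bool]_(m, n)) : Z0 A =
  (\sum_(U : {set 'I_n} | #|U| == N) [forall i, zero_row U (row_fun A i)])%N.
Proof.
pose neg (u : 'cV[bool]_n) : {set 'I_n} := [set j | u j 0]%SET.
rewrite (reindex neg) /=; last first.
  exists (fun U : {set 'I_n} => \col_j (j \in U)) => [u _|U _].
    by apply/matrixP => i j; rewrite mxE inE ord1.
  by apply/finset.setP => j; rewrite inE mxE.
have sgn (u : 'cV[bool]_n) (w : 'I_n -> nat) :
    \sum_j (w j)%:R * sign_vec u j 0 =
    (\sum_(j in ~: neg u) w j)%N%:R - (\sum_(j in neg u) w j)%N%:R :> int.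
  rewrite (bigID (mem (neg u))) /= addrC !natr_sum -sumrN; congr (_ + _).
    apply: eq_big => j; rewrite !inE // => /negbTE uj.
    by rewrite mxE uj expr0 mulr1.
  by apply: eq_bigr => j; rewrite inE mxE => ->; rewrite expr1 mulrN1.
have zr U i : zero_row U (row_fun A i) =
    (\sum_(j in ~: U) A i j == \sum_(j in U) A i j)%N.
  by rewrite /zero_row; congr (_ == _)%N; apply: eq_bigr => j _; rewrite ffunE.
rewrite /Z0 -sum1_card big_mkcond [in RHS]big_mkcond /=; apply: eq_bigr => u _.
have bal : (u \in balanced n) = (#|neg u| == N).
  rewrite inE (eq_bigr (fun j => 1%:R * sign_vec u j 0)); last first.
    by move=> j _; rewrite mul1r.
  rewrite (sgn u (fun=> 1%N)) !sum1_card cardsCs finset.setCK card_ord subr_eq0 eqr_nat.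
  have : (#|neg u| <= n)%N by rewrite -[X in (_ <= X)%N]card_ord max_card.
  by move: #|neg u| nN => c ->; lia.
rewrite inE bal; case: (#|neg u| == N) => //=.
have -> : (int_of_bool_mx A *m sign_vec u == 0) = [forall i, zero_row (neg u) (row_fun A i)].
  apply/eqP/forallP => [H i|H].
    have := congr1 (fun M : 'cV[int]_m => M i 0) H.
    rewrite !mxE; under eq_bigr do rewrite mxE.
    rewrite (sgn u (fun j => A i j : nat)) => /eqP; rewrite subr_eq0 eqr_nat.
    by rewrite zr.
  apply/matrixP => i j; rewrite ord1 !mxE; under eq_bigr do rewrite mxE.
  rewrite (sgn u (fun j => A i j : nat)); apply/eqP; rewrite subr_eq0 eqr_nat.
  by have := H i; rewrite zr.
by case: [forall i, _].
Qed.

Lemma mem_even_rows (A : 'M[bool]_(m, n)) :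
  (A \in even_rows m n) = [forall i, row_even (row_fun A i)].
Proof.
rewrite inE; apply: eq_forallb => i; congr (~~ odd _).
by apply: eq_bigr => j _; rewrite ffunE.
Qed.

(** Orthogonality to a balanced vector forces even rows, so the conditioning enters the moments only
    through the normalization. *)
Lemma sum_even_rows (Q : pred {ffun 'I_n -> bool}) : (forall r, Q r -> row_even r) ->
  \sum_(A in even_rows m n)
     bernoulli_ensemble p A * [forall i, Q (row_fun A i)]%:R =
  (\sum_(r | Q r) row_law p r) ^+ m.
Proof.
move=> Qe; rewrite -sum_ensemble_rows big_mkcond [RHS]big_mkcond /=.
apply: eq_bigr => A _; rewrite mem_even_rows.
case: (boolP [forall i, Q (row_fun A i)]) => [/forallP QA|_].
  by rewrite mulr1 ifT //; apply/forallP => i; apply: Qe.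
by rewrite mulr0; case: ifP.
Qed.

Lemma sum_Z0 :
  \sum_(A in even_rows m n) bernoulli_ensemble p A * (Z0 A)%:R =
  'C(n, N)%:R * tie_prob z N ^+ m.
Proof.
under eq_bigr do rewrite Z0_sum natr_sum mulr_sumr.
rewrite exchange_big /=.
rewrite (eq_bigr (fun=> tie_prob z N ^+ m)); last first.
  move=> U /eqP cU; rewrite sum_even_rows; last exact: zero_row_even.
  by rewrite sum_zero_row.
rewrite sumr_const -[LHS]mulr_natl; congr (_ * _); congr (_%:R).
by rewrite -[in RHS](card_ord n) -card_draws cardsE.
Qed.

(** [V] is split into its parts inside and outside [U]; the outer part has N - k elements, and 'C(N,
    N - k) = 'C(N, k). *)
Lemma card_draws_inter (U : {set 'I_n}) k : #|U| = N -> (k <= N)%N ->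
  #|[set V : {set 'I_n} | (#|V| == N) && (#|V :&: U| == k)]%SET| = ('C(N, k) * 'C(N, k))%N.
Proof.
move=> cU kN.
pose D1 := [set B : {set 'I_n} | B \subset U & #|B| == k]%SET.
pose D2 := [set B : {set 'I_n} | B \subset ~: U & #|B| == (N - k)%N]%SET.
have cC : #|~: U| = N by rewrite cardsCs finset.setCK card_ord cU nN; lia.
have IU (B1 B2 : {set 'I_n}) : B1 \subset U -> B2 \subset ~: U ->
    (B1 :|: B2) :&: U = B1 /\ (B1 :|: B2) :\: U = B2.
  move=> /fintype.subsetP s1 /fintype.subsetP s2; split; apply/finset.setP => j; rewrite !inE.
    have := s1 j; have := s2 j; rewrite !inE; case: (j \in U) (j \in B1) (j \in B2) => [] [] [] //=;
      by [move=> _ /(_ isT) | move=> /(_ isT)].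
  have := s1 j; have := s2 j; rewrite !inE; case: (j \in U) (j \in B1) (j \in B2) => [] [] [] //=;
      by [move=> _ /(_ isT) | move=> /(_ isT)].
have -> : ('C(N, k) * 'C(N, k))%N = #|finset.setX D1 D2|.
  by rewrite cardsX !cards_draws cU cC bin_sub.
rewrite -(@card_in_imset _ _ (fun B => B.1 :|: B.2)); last first.
  move=> [B1 B2] [B1' B2']; rewrite !finset.in_setX !inE /=.
  move=> /andP[/andP[s1 _] /andP[s2 _]] /andP[/andP[s1' _] /andP[s2' _]] /= e.
  have [e1 e2] := IU _ _ s1 s2; have [e1' e2'] := IU _ _ s1' s2'.
  by congr (_, _); [rewrite -e1 e | rewrite -e2 e].
apply: eq_card => V; rewrite inE; apply/andP/imsetP => [[/eqP cV /eqP cI]|[[B1 B2]]].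
  exists (V :&: U, V :\: U); last by rewrite /= finset.setID.
  rewrite finset.in_setX !inE /= finset.subsetIr cI eqxx /=.
  rewrite finset.setDE finset.subsetIr /= -finset.setDE.
  by have := cardsID U V; rewrite cV cI => <-; rewrite addKn.
rewrite finset.in_setX !inE /= => /andP[/andP[s1 /eqP c1] /andP[s2 /eqP c2]] ->.
have [e1 e2] := IU _ _ s1 s2.
rewrite e1 c1 eqxx -(cardsID U) e1 e2 c1 c2; split => //; apply/eqP; lia.
Qed.

Lemma sum_Z0_sqr :
  \sum_(A in even_rows m n) bernoulli_ensemble p A * (Z0 A)%:R ^+ 2 =
  'C(n, N)%:R * \sum_(k < N.+1)
     'C(N, k)%:R ^+ 2 * (tie_prob z k * tie_prob z (N - k)) ^+ m.
Proof.
transitivity (\sum_(U : {set 'I_n} | #|U| == N) \sum_(V : {set 'I_n} | #|V| == N)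
    \sum_(A in even_rows m n) bernoulli_ensemble p A *
      [forall i, zero_row U (row_fun A i) && zero_row V (row_fun A i)]%:R : R).
  under [RHS]eq_bigr do rewrite exchange_big.
  rewrite [RHS]exchange_big /=; apply: eq_bigr => A _.
  rewrite Z0_sum natr_sum expr2 big_distrlr mulr_sumr; apply: eq_bigr => U _.
  rewrite mulr_sumr; apply: eq_bigr => V _.
  rewrite /= -natrM mulnb; congr (_ * (nat_of_bool _)%:R).
  apply/andP/forallP => [[/forallP hU /forallP hV] i|H].
    by rewrite hU hV.
  by split; apply/forallP => i; have /andP[] := H i.
rewrite (eq_bigr (fun=> \sum_(k < N.+1)
     'C(N, k)%:R ^+ 2 * (tie_prob z k * tie_prob z (N - k)) ^+ m)); last first.
  move=> U /eqP cU.
  transitivity (\sum_(V : {set 'I_n} | #|V| == N)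
      (tie_prob z #|V :&: U| * tie_prob z (N - #|V :&: U|)) ^+ m).
    apply: eq_bigr => V /eqP cV; rewrite (@sum_even_rows (fun r => zero_row U r && zero_row V r)).
      by rewrite sum_zero_row2.
    move=> r /andP[+ _].
    exact: zero_row_even.
  have le (V : {set 'I_n}) : #|V| == N -> (#|V :&: U| < N.+1)%N.
    by move=> /eqP <-; rewrite ltnS subset_leq_card // finset.subsetIl.
  rewrite (partition_big (fun V : {set 'I_n} => inord #|V :&: U| : 'I_N.+1) xpredT) //=.
  apply: eq_bigr => k _.
  have kN : (k <= N)%N by rewrite -ltnS.
  rewrite -natrX -mulnn -(card_draws_inter cU kN) mulr_natl -sumr_const.
  apply: eq_big => [V|V /andP[cV /eqP <-]]; last by rewrite inordK ?le.
  rewrite inE; case: (boolP (#|V| == N)) => //= cV.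
  by rewrite -(inj_eq val_inj) /= inordK ?le.
rewrite sumr_const -[LHS]mulr_natl; congr (_ * _); congr (_%:R).
by rewrite -[in RHS](card_ord n) -card_draws cardsE.
Qed.

End Moments.

Lemma second_moment_ratioE (R : realType) (m N : nat) (p : R) : 0 < p <= 2^-1 ->
  second_moment_ratio m N.*2 p =
  \sum_(k < N.+1) 'C(N, k)%:R ^+ 2 / 'C(N.*2, N)%:R *
     overlap_factor (4 * p * (1 - p)) k (N - k) ^+ m.
Proof.
move=> /andP[p0 p2]; set z := 4 * p * (1 - p).
have z01 : 0 < z <= 1.
  by rewrite mulr_gt0 ?mulr_gt0 //=; [rewrite /z; have := sqr_ge0 (1 - 2 * p); lra | lra].
have f0 : 0 < tie_prob z N by rewrite tie_prob_gt0 //; lra.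
have C0 : 0 < 'C(N.*2, N)%:R :> R by rewrite ltr0n bin_gt0 -addnn leq_addr.
rewrite /second_moment_ratio /condE (sum_Z0 m p (erefl N.*2)).
rewrite (sum_Z0_sqr m p (erefl N.*2)) prob_even_rows -/z.
have -> : (1 - 2 * p) ^+ N.*2 = (1 - z) ^+ N.
  by rewrite -mul2n exprM; congr (_ ^+ _); rewrite /z; ring.
set e := (1 + (1 - z) ^+ N) / 2.
have e0 : 0 < e.
  by rewrite divr_gt0 // ltr_pwDl // exprn_ge0 //; lra.
have em0 : 0 < e ^+ m by rewrite exprn_gt0.
have fm0 : 0 < tie_prob z N ^+ m by rewrite exprn_gt0.
rewrite mulr_sumr 2!mulr_suml; apply: eq_bigr => k _.
rewrite /overlap_factor subnKC -/e; last by rewrite -ltnS.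
clearbody e; rewrite [in RHS]expr_div_n [(e * _) ^+ m]exprMn.
rewrite -exprM [(2 * m)%N]mulnC exprM.
move: ('C(N, k)%:R : R) ((tie_prob z k * _) ^+ m : R) => c g.
move: ('C(N.*2, N)%:R : R) (e ^+ m) (tie_prob z N ^+ m) C0 em0 fm0 => b x y b0 x0 y0.
by field; rewrite !gt_eqF.
Qed.

(** * Exponential moments of squared binomial deviations *)

(** For |y| <= 1/2 this follows from exp u <= 1 / (1 - u); the duplication formula cosh (2 u) = 2
    cosh(u)^2 - 1 then doubles the range at each step of an induction. *)
Lemma cosh_le_expR (R : realType) (y : R) : expR y + expR (- y) <= 2 * expR (2 * y ^+ 2).
Proof.
have small (u : R) : `|u| <= 2^-1 -> expR u + expR (- u) <= 2 * expR (2 * u ^+ 2).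
  rewrite ler_norml => /andP[u1 u2].
  have inv (v : R) : v < 1 -> expR v <= (1 - v)^-1.
    move=> v1; rewrite -[leLHS]invrK -expRN lef_pV2 ?posrE ?expR_gt0 ?subr_gt0 //.
    by rewrite expR_ge1Dx.
  have e1 : expR u <= (1 - u)^-1 by apply: inv; lra.
  have e2 : expR (- u) <= (1 + u)^-1 by rewrite -[in leRHS](opprK u); apply: inv; lra.
  have uu : 0 <= u ^+ 2 <= 2^-1 by rewrite sqr_ge0 /=; nra.
  have := inv1B_le_expR uu.
  have -> : (1 - u ^+ 2)^-1 = ((1 - u)^-1 + (1 + u)^-1) / 2.
    by field; rewrite !gt_eqF //; nra.
  lra.
have double (u : R) : expR u + expR (- u) <= 2 * expR (2 * u ^+ 2) ->
    expR (2 * u) + expR (- (2 * u)) <= 2 * expR (2 * (2 * u) ^+ 2).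
  have -> : expR (2 * (2 * u) ^+ 2) = expR (2 * u ^+ 2) ^+ 4.
    by rewrite -expRM_natl; congr expR; ring.
  move: (expR (2 * u ^+ 2)) => E.
  have -> : - (2 * u) = 2 * (- u) by ring.
  rewrite !expRM_natl.
  have xy : expR u * expR (- u) = 1 by rewrite expRxMexpNx_1.
  have : 0 < expR u + expR (- u) by rewrite addr_gt0 ?expR_gt0.
  move: (expR u) (expR (- u)) xy => a b ab.
  have -> : a ^+ 2 + b ^+ 2 = (a + b) ^+ 2 - 2.
    have -> : (a + b) ^+ 2 - 2 = a ^+ 2 + b ^+ 2 + 2 * (a * b - 1) by ring.
    by rewrite ab subrr mulr0 addr0.
  move: (a + b) => s s0 sE.
  have s2E : (s / 2) ^+ 2 <= E ^+ 2 by rewrite lerXn2r ?nnegrE //; lra.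
  have : ((s / 2) ^+ 2) ^+ 2 <= (E ^+ 2) ^+ 2 by rewrite lerXn2r ?nnegrE ?sqr_ge0.
  rewrite -(exprM E) => h; have := sqr_ge0 ((s / 2) ^+ 2 - 1).
  lra.
have dyadic k (u : R) : `|u| <= 2 ^+ k / 2 -> expR u + expR (- u) <= 2 * expR (2 * u ^+ 2).
  elim: k u => [|k IH] u uk; first by apply: small; rewrite expr0 mul1r in uk.
  have -> : u = 2 * (u / 2) by field.
  apply/double/IH; rewrite normrM [`|2^-1|]ger0_norm // ler_pdivrMr //.
  by rewrite exprS in uk; lra.
apply: (dyadic (Num.bound `|y|).+1).
rewrite exprS [2 * _]mulrC mulfK //.
apply/ltW/(lt_le_trans (archi_boundP (normr_ge0 y))).
by rewrite -natrX ler_nat ltnW // ltn_expl.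
Qed.

(** Convexity of exp between 0 and x, through tangent bounds at [lam * x]. A small multiple of the
    overlap deviation thus costs only 1 + O(lam) on average. *)
Lemma expR_scale_le (R : realType) (lam x : R) : 0 <= lam <= 1 ->
  expR (lam * x) <= 1 + lam * expR x.
Proof.
move=> /andP[l0 l1].
have h1 : expR (lam * x) * (1 + (1 - lam) * x) <= expR x.
  have {3}-> : x = lam * x + (1 - lam) * x by ring.
  by rewrite expRD ler_wpM2l ?expR_ge0 ?expR_ge1Dx.
have h2 : expR (lam * x) * (1 - lam * x) <= 1.
  rewrite -[leRHS](expRxMexpNx_1 (lam * x)) ler_wpM2l ?expR_ge0 //.
  by apply: le_trans (expR_ge1Dx _).
have : lam * (expR (lam * x) * (1 + (1 - lam) * x)) <= lam * expR x by rewrite ler_wpM2l.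
have : (1 - lam) * (expR (lam * x) * (1 - lam * x)) <= (1 - lam) * 1.
  by rewrite ler_wpM2l // subr_ge0.
lra.
Qed.

(** Induction on N for a simple random walk started at x. Pascal's rule splits off one step, and
    [cosh_le_expR] raises the coefficient b of x^2 to at most b + 8 b^2, which b_N = a / (1 - 8 a N)
    absorbs: b_N + 8 b_N^2 <= b_(N + 1). *)
Lemma binomial_square_mgf (R : realType) N (a x : R) : 0 <= a -> 8 * a * N%:R < 1 ->
  \sum_(k < N.+1) 'C(N, k)%:R * expR (a * (x + (2 * k)%:R - N%:R) ^+ 2) <=
  2 ^+ N * expR (a / (1 - 8 * a * N%:R) * (x ^+ 2 + N%:R)).
Proof.
move=> a0; elim: N x => [|N IH] x aN.
  by rewrite big_ord1 bin0 !mul1r muln0 mulr0 !subr0 addr0 divr1 addr0.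
have aN' : 8 * a * N%:R < 1.
  by apply: le_lt_trans aN; rewrite ler_wpM2l ?mulr_ge0 // ler_nat.
pose G y := \sum_(k < N.+1) 'C(N, k)%:R * expR (a * (y + (2 * k)%:R - N%:R) ^+ 2).
have E u v : u = v -> expR (a * u ^+ 2) = expR (a * v ^+ 2) by move=> ->.
have -> : \sum_(k < N.+2) 'C(N.+1, k)%:R * expR (a * (x + (2 * k)%:R - N.+1%:R) ^+ 2)
    = G (x - 1) + G (x + 1).
  rewrite big_ord_recl /= bin0.
  under eq_bigr do rewrite /bump /= add1n binS natrD mulrDl.
  rewrite big_split /= addrA; congr (_ + _).
    rewrite big_ord_recr /= bin_small // mul0r !addr0 /G big_ord_recl bin0 muln0 addr0; congr (_ + _).
      by rewrite -[N.+1%:R]natr1; congr (_ * _); apply: E; ring.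
    apply: eq_bigr => k _; rewrite lift0.
    by rewrite -[N.+1%:R]natr1; congr (_ * _); apply: E; ring.
  apply: eq_bigr => k _.
  by rewrite mulnS natrD -[N.+1%:R]natr1; congr (_ * _); apply: E; ring.
set b := a / (1 - 8 * a * N%:R) in IH.
have b0 : 0 <= b by rewrite divr_ge0 // subr_ge0 ltW.
apply: (le_trans (lerD (IH _ aN') (IH _ aN'))).
rewrite -mulrDr (exprSr 2 N) -(mulrA (2 ^+ N)) ler_wpM2l ?exprn_ge0 //.
have -> : b * ((x - 1) ^+ 2 + N%:R) = b * (x ^+ 2 + N.+1%:R) + - (2 * b * x).
  by rewrite -natr1; ring.
have -> : b * ((x + 1) ^+ 2 + N%:R) = b * (x ^+ 2 + N.+1%:R) + (2 * b * x).
  by rewrite -natr1; ring.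
rewrite !expRD -mulrDr.
have h := cosh_le_expR (2 * b * x).
apply: (@le_trans _ _ (expR (b * (x ^+ 2 + N.+1%:R)) * (2 * expR (2 * (2 * b * x) ^+ 2)))).
  by rewrite ler_wpM2l ?expR_ge0 // addrC.
rewrite mulrCA -expRD ler_wpM2l // ler_expR.
have e1 : 1 - 8 * a * N.+1%:R = 1 - 8 * a * N%:R - 8 * a by rewrite -natr1; ring.
have d1 : 0 < 1 - 8 * a * N%:R - 8 * a by rewrite -e1 subr_gt0.
have d0 : 0 < 1 - 8 * a * N%:R by rewrite subr_gt0.
have key : b + 8 * b ^+ 2 <= a / (1 - 8 * a * N.+1%:R).
  rewrite e1 /b; move: (1 - _ * N%:R) d0 d1 => d d0 d1.
  rewrite ler_pdivlMr // -subr_ge0.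
  have -> : a - (a / d + 8 * (a / d) ^+ 2) * (d - 8 * a) = 64 * a ^+ 3 / d ^+ 2.
    by field; rewrite gt_eqF.
  by rewrite divr_ge0 ?sqr_ge0 // mulr_ge0 // exprn_ge0.
have x0 : 0 <= x ^+ 2 by rewrite sqr_ge0.
have h1 : (b + 8 * b ^+ 2) * x ^+ 2 <= a / (1 - 8 * a * N.+1%:R) * x ^+ 2.
  by rewrite ler_wpM2r.
have h2 : b * N.+1%:R <= a / (1 - 8 * a * N.+1%:R) * N.+1%:R.
  rewrite ler_wpM2r //; apply: le_trans key.
  by rewrite lerDl mulr_ge0 ?sqr_ge0.
rewrite mulrDr [leRHS]mulrDr.
have -> : b * x ^+ 2 + b * N.+1%:R + 2 * (2 * b * x) ^+ 2 =
    (b + 8 * b ^+ 2) * x ^+ 2 + b * N.+1%:R by ring.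
exact: lerD.
Qed.

(** * The hypergeometric law of the overlap *)

Section OverlapLaw.
Variables (R : realType) (N : nat).

(** The law of the size of the intersection of two independent uniform N-subsets of 2 N points. *)
Definition overlap_law (k : nat) : R := 'C(N, k)%:R ^+ 2 / 'C(N.*2, N)%:R.

Lemma overlap_law_ge0 k : 0 <= overlap_law k.
Proof. by rewrite divr_ge0 ?sqr_ge0. Qed.

Lemma sum_overlap_law : \sum_(k < N.+1) overlap_law k = 1.
Proof.
rewrite -mulr_suml.
have -> : \sum_(k < N.+1) 'C(N, k)%:R ^+ 2 = 'C(N.*2, N)%:R :> R.
  rewrite -addnn -binomial.Vandermonde natr_sum; apply: eq_bigr => k _.
  by rewrite natrM bin_sub // -ltnS.
by rewrite divff // pnatr_eq0 -lt0n bin_gt0 -addnn leq_addr.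
Qed.

Lemma leq_bin_upper n k l : (n <= k.*2)%N -> (k <= l)%N -> ('C(n, l) <= 'C(n, k))%N.
Proof.
move=> nk; elim: l => [|l IH]; first by rewrite leqn0 => /eqP ->.
rewrite leq_eqVlt => /predU1P[<-//|]; rewrite ltnS => kl.
apply: leq_trans (IH kl).
rewrite -(leq_pmul2l (ltn0Sn l)) mul_bin_left leq_mul2r; apply/orP; right; lia.
Qed.

Lemma leq_bin_uphalf n k : ('C(n, k) <= 'C(n, uphalf n))%N.
Proof.
have n2 : (n <= (uphalf n).*2)%N by lia.
have [kn|nk] := leqP k n; last by rewrite bin_small.
have [h|h] := leqP (uphalf n) k; first exact: leq_bin_upper.
have [e|ne] := eqVneq (n - k)%N (uphalf n); first by rewrite -bin_sub // e.
by rewrite -bin_sub //; apply: leq_bin_upper => //; lia.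
Qed.

Lemma arcsine_moment_mono i j : (i <= j)%N ->
  i%:R * arcsine_moment R i <= j%:R * arcsine_moment R j.
Proof.
move=> /subnK <-; elim: (j - i)%N => [|d IH]; first by rewrite add0n.
apply: (le_trans IH); rewrite addSn arcsine_momentS ler_wpM2r //; last by rewrite lerDl.
exact/ltW/arcsine_moment_gt0.
Qed.

(** For odd n the central coefficient is half of that of n + 1, which makes one formula serve both
    parities. *)
Lemma bin_uphalf n : 'C(n, uphalf n)%:R = 2 ^+ n * arcsine_moment R (uphalf n).
Proof.
rewrite /arcsine_moment; set u := uphalf n.
have e4 : (4 ^+ u : R) != 0 by rewrite expf_neq0.
have [no|ne] := boolP (odd n).
  have nu : n.+1 = u.*2 by rewrite /u; lia.
  have u0 : (0 < u)%N by rewrite /u; lia.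
  have c : ('C(u.*2, u) = 2 * 'C(n, u))%N.
    rewrite -nu -{1}(prednK u0) binS prednK // -(@bin_sub n u); last by lia.
    by rewrite (_ : n - u = u.-1)%N; lia.
  have p4 : 4 ^+ u = 2 * 2 ^+ n :> R.
    by rewrite -exprS nu -mul2n exprM; congr (_ ^+ _); ring.
  by rewrite c natrM p4; field; rewrite expf_neq0.
have nu : n = u.*2 by rewrite /u; lia.
have p4 : 4 ^+ u = 2 ^+ n :> R by rewrite nu -mul2n exprM; congr (_ ^+ _); ring.
by rewrite -nu p4 mulrC mulfVK // expf_neq0.
Qed.

(** Comparison with the binomial law. It reduces to mu_u <= 2 mu_N for arcsine moments with u =
    [uphalf N], true because i mu_i is nondecreasing and N <= 2 u. *)
Lemma overlap_law_le k : overlap_law k <= 2 * ('C(N, k)%:R / 2 ^+ N).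
Proof.
have p0 : 0 < 2 ^+ N :> R by rewrite exprn_gt0.
have C0 : 0 < 'C(N.*2, N)%:R :> R by rewrite ltr0n bin_gt0 -addnn leq_addr.
suff h : 'C(N, k)%:R * 2 ^+ N <= 2 * 'C(N.*2, N)%:R :> R.
  rewrite ler_pdivrMr // mulrA mulrAC ler_pdivlMr // expr2 -mulrA.
  by rewrite [leRHS](_ : _ = 'C(N, k)%:R * (2 * 'C(N.*2, N)%:R)) ?ler_wpM2l //; ring.
have e : 'C(N.*2, N)%:R = 4 ^+ N * arcsine_moment R N.
  by rewrite /arcsine_moment mulrC mulfVK // expf_neq0.
apply: (@le_trans _ _ ('C(N, uphalf N)%:R * 2 ^+ N)).
  by rewrite ler_pM2r // ler_nat leq_bin_uphalf.
rewrite bin_uphalf e mulrAC -exprMn (_ : 2 * 2 = 4); last by ring.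
rewrite [leRHS]mulrCA ler_pM2l ?exprn_gt0 //.
have [N0|N0] := posnP N.
  by rewrite N0 /= -[leLHS]mul1r ler_pM2r ?arcsine_moment_gt0 // ler1n.
have u0 : 0 < (uphalf N)%:R :> R by rewrite ltr0n; lia.
rewrite -(ler_pM2l u0); have uN : (uphalf N <= N)%N by lia.
apply: (le_trans (arcsine_moment_mono uN)).
rewrite [leRHS]mulrCA [leRHS]mulrA ler_wpM2r ?(ltW (arcsine_moment_gt0 _ _)) //.
by rewrite -natrM ler_nat; lia.
Qed.

(** The coefficient 1 / (16 N) is half of the critical value 1 / (8 N) of [binomial_square_mgf], so
    the exponential has bounded mean. *)
Definition overlap_dev (k : nat) : R := ((2 * k)%:R - N%:R) ^+ 2 / (16 * N%:R).

Lemma overlap_law_mgf : (0 < N)%N ->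
  \sum_(k < N.+1) overlap_law k * expR (overlap_dev k) <= 4.
Proof.
move=> N0; have NR : 0 < N%:R :> R by rewrite ltr0n.
have p0 : 0 < 2 ^+ N :> R by rewrite exprn_gt0.
pose a : R := (16 * N%:R)^-1.
have aN : 8 * a * N%:R = 1 / 2 by rewrite /a; field; rewrite gt_eqF.
have a0 : 0 <= a by rewrite invr_ge0 mulr_ge0.
have aN1 : 8 * a * N%:R < 1 by rewrite aN; lra.
have := binomial_square_mgf 0 a0 aN1.
have -> : a / (1 - 8 * a * N%:R) * (0 ^+ 2 + N%:R) = 1 / 8.
  by rewrite aN /a; field; rewrite gt_eqF.
move=> H.
apply: (@le_trans _ _ (\sum_(k < N.+1) 2 / 2 ^+ N *
    ('C(N, k)%:R * expR (a * (0 + (2 * k)%:R - N%:R) ^+ 2)))).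
  apply: ler_sum => k _; rewrite mulrA.
  apply: ler_pM; rewrite ?overlap_law_ge0 ?expR_ge0 //.
    by apply: (le_trans (overlap_law_le k)); rewrite mulrA mulrAC.
  by rewrite add0r /overlap_dev mulrC.
rewrite -mulr_sumr mulrAC ler_pdivrMr //.
have e2 : expR (1 / 8) <= 2 :> R.
  have h : expR (- (1 / 8)) >= 1 / 2 :> R by apply: le_trans (expR_ge1Dx _); lra.
  rewrite expRN in h.
  rewrite -lef_pV2 ?posrE ?expR_gt0 //; lra.
have : 2 ^+ N * expR (1 / 8) <= 2 ^+ N * 2 :> R by rewrite ler_pM2l.
lra.
Qed.

End OverlapLaw.

(** * Bounds on the second moment ratio for fixed parameters *)

(** Cauchy-Schwarz, from the nonnegative quadratic form [sq] at c = W and d = S. *)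
Lemma sqr_weighted_sum_le (R : realType) (I : finType) (Q : {set I}) (w X : I -> R) :
  (forall i, 0 <= w i) -> 0 < \sum_(i in Q) w i ->
  (\sum_(i in Q) w i * X i) ^+ 2 <=
  (\sum_(i in Q) w i) * \sum_(i in Q) w i * X i ^+ 2.
Proof.
move=> w0 W0.
have sq c d : 0 <= c ^+ 2 * (\sum_(i in Q) w i * X i ^+ 2)
    - 2 * c * d * (\sum_(i in Q) w i * X i) + d ^+ 2 * \sum_(i in Q) w i.
  rewrite !mulr_sumr -sumrB -big_split /=; apply: sumr_ge0 => i _.
  rewrite [leRHS](_ : _ = w i * (c * X i - d) ^+ 2); last by ring.
  by rewrite mulr_ge0 ?sqr_ge0.
move: (\sum_(i in Q) w i) (\sum_(i in Q) w i * X i) (\sum_(i in Q) w i * X i ^+ 2) W0 sq.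
move=> W S T W0 sq.
rewrite -subr_ge0 -(pmulr_rge0 _ W0).
have -> : W * (W * T - S ^+ 2) = W ^+ 2 * T - 2 * W * S * S + S ^+ 2 * W by ring.
exact: sq.
Qed.

Section RatioBounds.
Variables (R : realType) (m N : nat) (p : R).
Hypothesis p01 : 0 < p <= 2^-1.

Local Notation z := (4 * p * (1 - p)).

Lemma edge_density_gt0 : 0 < z <= 1.
Proof.
move: p01 => /andP[p0 p2].
have := sqr_ge0 (1 - 2 * p) => h.
by rewrite mulr_gt0 ?mulr_gt0 //=; lra.
Qed.

Lemma second_moment_ratio_ge1 : 1 <= second_moment_ratio m N.*2 p.
Proof.
have z01 := edge_density_gt0.
have p01' : 0 <= p <= 1 by case/andP: p01 => p0 p2; rewrite (ltW p0) /=; lra.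
rewrite /second_moment_ratio /condE.
set P := prob p _; set S1 := \sum_(A in _) _; set S2 := \sum_(A in _) _.
have w0 (A : 'M[bool]_(m, N.*2)) : 0 <= bernoulli_ensemble p A.
  by apply: prodr_ge0 => i _; apply: prodr_ge0 => j _; exact: bernoulli_pmf_ge0.
have P0 : 0 < P.
  rewrite /P prob_even_rows exprn_gt0 // divr_gt0 // ltr_pwDl //.
  by rewrite -mul2n exprM exprn_ge0 // sqr_ge0.
have S10 : 0 < S2.
  rewrite /S2 (sum_Z0 m p (erefl N.*2)) mulr_gt0 //.
    by rewrite ltr0n bin_gt0 -addnn leq_addr.
  by case/andP: z01 => z0 z1; rewrite exprn_gt0 // tie_prob_gt0 // (ltW z0).
have cs : S2 ^+ 2 <= P * S1 by exact: sqr_weighted_sum_le.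
rewrite ler_pdivlMr ?exprn_gt0 ?divr_gt0 // mul1r.
rewrite expr_div_n ler_pdivrMr ?exprn_gt0 //.
by rewrite [leRHS](_ : _ = P * S1) //; move: (P) (S1) P0 => x y x0; field; rewrite gt_eqF.
Qed.

Let N0 : (0 < N)%N -> 0 < N%:R :> R. Proof. by move=> h; rewrite ltr0n. Qed.

(** The range where the sharp bounds on [overlap_factor] apply. Outside it |2 k - N| >= N / 2, hence
    the value N / 64 in the tail estimate. *)
Let middle (k : nat) : bool := (N <= 4 * k)%N && (N <= 4 * (N - k))%N.

Lemma overlap_dev_tail k : (0 < N)%N -> (k <= N)%N -> ~~ middle k ->
  N%:R / 64 <= overlap_dev R N k.
Proof.
move=> /N0 NR kN nmid; rewrite /overlap_dev ler_pdivlMr ?mulr_gt0 //.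
have -> : N%:R / 64 * (16 * N%:R) = (N%:R / 2) ^+ 2 :> R by field.
have [h|h] : (4 * k <= N)%N \/ (3 * N <= 4 * k)%N by move: nmid; rewrite /middle; lia.
  have {}h : 4 * k%:R <= N%:R :> R by rewrite -natrM ler_nat.
  rewrite -[leRHS]sqrrN lerXn2r ?nnegrE ?natrM //; lra.
have {}h : 3 * N%:R <= 4 * k%:R :> R by rewrite -!natrM ler_nat.
rewrite lerXn2r ?nnegrE ?natrM //; lra.
Qed.

(** On [middle], m ((2 k - N) / N)^2 is [lam * overlap_dev] with lam = 16 m / N, which
    [expR_scale_le] linearizes. Elsewhere the crude bound is multiplied by exp ([overlap_dev] - N /
    64) >= 1. Averaging by [overlap_law_mgf] gives the constants 4 and 64 = 4 * 16. *)
Lemma second_moment_ratio_le : (0 < N)%N -> 192 <= z * N%:R -> (16 * m <= N)%N ->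
  second_moment_ratio m N.*2 p <=
  expR (193 * (m%:R / (z * N%:R))) * (1 + 64 * (m%:R / N%:R)) +
  4 * ((2 * N%:R) ^+ (2 * m) * expR (- (N%:R / 64))).
Proof.
move=> Npos zN mN; have NR := N0 Npos; have z01 := edge_density_gt0.
have mgf := overlap_law_mgf R Npos; have tot := sum_overlap_law R N.
rewrite second_moment_ratioE //.
set e := 193 * _; set lam : R := 16 * (m%:R / N%:R).
have lam01 : 0 <= lam <= 1.
  rewrite mulr_ge0 ?divr_ge0 //= /lam mulrA ler_pdivrMr // mul1r -natrM ler_nat //.
have bound (k : 'I_N.+1) : overlap_factor z k (N - k) ^+ m <=
    expR e * (1 + lam * expR (overlap_dev R N k)) +
    (2 * N%:R) ^+ (2 * m) * expR (- (N%:R / 64)) * expR (overlap_dev R N k).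
  have kN : (k <= N)%N by rewrite -ltnS.
  have eN : (k + (N - k))%N = N by rewrite subnKC.
  have [/andP[h1 h2]|nmid] := boolP (middle k).
    apply: (@le_trans _ _ (expR e * (1 + lam * expR (overlap_dev R N k)))); last first.
      by rewrite lerDl !mulr_ge0 ?expR_ge0 ?exprn_ge0 ?mulr_ge0.
    apply: (@le_trans _ _ (expR (m%:R *
        ((k%:R - (N - k)%:R) ^+ 2 / N%:R ^+ 2 + 193 / (z * N%:R))))).
      rewrite expRM_natl lerXn2r ?nnegrE ?overlap_factor_ge0 ?expR_ge0 //.
      by have := @overlap_factor_le _ _ z01 k (N - k); rewrite eN; apply.
    have -> : m%:R * ((k%:R - (N - k)%:R) ^+ 2 / N%:R ^+ 2 + 193 / (z * N%:R)) =
       e + lam * overlap_dev R N k :> R.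
      rewrite /e /lam /overlap_dev natrB // natrM.
      have z0 : 0 < z by case/andP: z01.
      move: (z) (N%:R : R) (m%:R : R) (k%:R : R) z0 NR => ? ? ? ? z0 NR.
      by field; rewrite !gt_eqF.
    by rewrite expRD ler_wpM2l ?expR_ge0 ?expR_scale_le.
  apply: (@le_trans _ _ ((2 * N%:R) ^+ (2 * m) * expR (- (N%:R / 64)) *
      expR (overlap_dev R N k))); last first.
    by rewrite lerDr mulr_ge0 ?expR_ge0 // addr_ge0 // mulr_ge0 ?expR_ge0 //; lra.
  apply: (@le_trans _ _ ((2 * N%:R) ^+ (2 * m))).
    rewrite exprM lerXn2r ?nnegrE ?overlap_factor_ge0 ?sqr_ge0 //.
    by have := @overlap_factor_crude _ _ z01 k (N - k); rewrite eN; apply.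
  rewrite -mulrA ler_peMr ?exprn_ge0 ?mulr_ge0 // -expRD -[leLHS]expR0 ler_expR.
  by rewrite addrC subr_ge0 overlap_dev_tail.
apply: (@le_trans _ _ (\sum_(k < N.+1) (expR e * overlap_law R N k +
   (expR e * lam + (2 * N%:R) ^+ (2 * m) * expR (- (N%:R / 64))) *
      (overlap_law R N k * expR (overlap_dev R N k))))).
  apply: ler_sum => k _.
  apply: (le_trans (ler_wpM2l (overlap_law_ge0 R N k) (bound k))).
  rewrite le_eqVlt; apply/orP; left; apply/eqP; ring.
rewrite big_split /= -!mulr_sumr tot.
set T := (2 * N%:R) ^+ (2 * m) * _.
have T0 : 0 <= T by rewrite mulr_ge0 ?exprn_ge0 ?mulr_ge0 ?expR_ge0.
have c0 : 0 <= expR e * lam + T by rewrite addr_ge0 // mulr_ge0 ?expR_ge0 //; lra.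
apply: (le_trans (lerD (lexx _) (ler_wpM2l c0 mgf))).
rewrite /lam; move: (m%:R / N%:R) (expR e) => x y; lra.
Qed.

Lemma second_moment_ratio_ge : (0 < N)%N -> 768 <= z * N%:R -> z <= 1 / 64 ->
  (1 - 4 * expR (- (N%:R / 64))) * expR (m%:R / (1024 * (z * N%:R))) <=
  second_moment_ratio m N.*2 p.
Proof.
move=> Npos zN z64; have NR := N0 Npos; have z01 := edge_density_gt0.
have mgf := overlap_law_mgf R Npos; have tot := sum_overlap_law R N.
rewrite second_moment_ratioE //.
(* Markov's inequality for the exponential of [overlap_dev]. *)
have tail : \sum_(k < N.+1 | ~~ middle k) overlap_law R N k <= 4 * expR (- (N%:R / 64)).
  rewrite expRN ler_pdivlMr ?expR_gt0 // mulr_suml; apply: le_trans mgf.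
  rewrite big_mkcond /=; apply: ler_sum => k _.
  case: ifP => [nmid|_]; last by rewrite mulr_ge0 ?overlap_law_ge0 ?expR_ge0.
  rewrite ler_wpM2l ?overlap_law_ge0 // ler_expR overlap_dev_tail //.
  by rewrite -ltnS.
have mid : 1 - 4 * expR (- (N%:R / 64)) <= \sum_(k < N.+1 | middle k) overlap_law R N k.
  by rewrite lerBlDr -[leLHS]tot (bigID (fun k : 'I_N.+1 => middle k)) /= lerD2l.
apply: (le_trans (ler_wpM2r (expR_ge0 _) mid)).
rewrite mulr_suml big_mkcond /=; apply: ler_sum => k _.
case: ifP => [/andP[h1 h2]|_]; last first.
  by rewrite mulr_ge0 ?overlap_law_ge0 // exprn_ge0 // overlap_factor_ge0.
rewrite ler_wpM2l ?overlap_law_ge0 // -[m%:R / _]mulr1 mulrAC -mulrA expRM_natl.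
have kN : (k <= N)%N by rewrite -ltnS.
have eN : (k + (N - k))%N = N by rewrite subnKC.
rewrite lerXn2r ?nnegrE ?overlap_factor_ge0 ?expR_ge0 //.
by have := @overlap_factor_ge _ _ z01 k (N - k); rewrite eN; apply.
Qed.

End RatioBounds.

(** * Asymptotics in the two regimes *)

(** The claim amounts to 2 m ln x <= x / 256. If x <= m^2, then ln x <= 2 ln m and the first
    hypothesis suffices. Otherwise let r = x^(1/4): m <= r^2 and ln x <= 4 r, so 2 m ln x <= 8 r^3
    <= x / 256 because r >= 2048. *)
Lemma exprn_mul_expR_le (R : realType) (m : nat) (x : R) : (0 < m)%N ->
  1024 * m%:R * ln m%:R <= x -> 2048 ^+ 4 <= x ->
  x ^+ (2 * m) * expR (- (x / 128)) <= expR (- (x / 256)).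
Proof.
move=> m0 xm xK.
have mR : 1 <= m%:R :> R by rewrite ler1n.
have x1 : 1 <= x by apply: le_trans xK; rewrite exprn_ege1 // ler1n.
have x0 : 0 < x by apply: lt_le_trans x1.
suff key : (2 * m)%:R * ln x <= x / 256.
  rewrite -{1}(lnK x0) -expRM_natl -expRD ler_expR; lra.
rewrite natrM -subr_ge0.
have [xm2|xm2] := lerP x (m%:R ^+ 2).
  clear xK.
  have : ln x <= ln (m%:R ^+ 2) by rewrite ler_ln ?posrE ?exprn_gt0 ?ltr0n.
  rewrite lnXn; last by rewrite ltr0n.
  rewrite -[ln _ *+ 2]mulr_natr => lnx.
  have : m%:R * ln x <= m%:R * (ln m%:R * 2) by rewrite ler_wpM2l.
  lra.
pose r := Num.sqrt (Num.sqrt x).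
have r0 : 0 < r by rewrite !sqrtr_gt0.
have r2 : r ^+ 2 = Num.sqrt x by rewrite sqr_sqrtr ?sqrtr_ge0.
have r4 : r ^+ 4 = x by rewrite (exprM r 2 2) r2 sqr_sqrtr // ltW.
have le4 (u : R) : 0 <= u -> u ^+ 4 <= x -> u <= r.
  by move=> u0; rewrite -r4 ler_pXn2r ?nnegrE // ltW.
have rK : 2048 <= r := le4 2048 (ler0n _ _) xK.
have mr : m%:R <= r ^+ 2.
  rewrite -(@ler_pXn2r _ 2) ?nnegrE ?sqr_ge0 // -exprM r4; exact: ltW.
have lnx : ln x <= 4 * r.
  rewrite -r4 lnXn // -[ln _ *+ 4]mulr_natl ler_wpM2l //.
  exact/ltW/ln_sublinear.
have ml : m%:R * ln x <= r ^+ 2 * (4 * r) by rewrite ler_pM // ln_ge0.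
have r3 : 2048 * r ^+ 3 <= r * r ^+ 3 by rewrite ler_wpM2r // exprn_ge0 // ltW.
have e3 : r ^+ 2 * (4 * r) = 4 * r ^+ 3 by ring.
have e4 : r * r ^+ 3 = x by rewrite -exprS r4.
rewrite e3 in ml; rewrite e4 in r3.
rewrite -mulrA; move: ml r3; move: (m%:R * ln x) (r ^+ 3) => u v; lra.
Qed.

Lemma cvg_lny_nat (R : realType) : (fun m : nat => ln m%:R : R) @ \oo --> +oo.
Proof.
apply/cvgryPge => A; near=> m.
rewrite -[leLHS]expRK ler_ln ?posrE ?expR_gt0 //; first by near: m; exact: nbhs_infty_ger.
by apply: (@lt_le_trans _ _ (expR A)); [exact: expR_gt0|near: m; exact: nbhs_infty_ger].
Unshelve. all: by end_near. Qed.

Section Asymptotics.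
Variables (R : realType) (n : nat -> nat) (p : nat -> R).
Hypothesis n_even : forall m, ~~ odd (n m).
Hypothesis p_half : forall m, 0 < p (n m) <= 2^-1.
Hypothesis n_large : forall m, 1024 * m%:R * ln m%:R <= (n m)%:R :> R.

Let x m : R := (n m)%:R * p (n m).
Let N m := (n m)./2.
Let z m : R := 4 * p (n m) * (1 - p (n m)).
Let rho m := second_moment_ratio m (n m) (p (n m)).

Hypothesis x_oo : x @ \oo --> +oo.

Let nN m : n m = (N m).*2.
Proof. by rewrite even_halfK. Qed.

Let nNR m : (n m)%:R = 2 * (N m)%:R :> R.
Proof. by rewrite -natrM mul2n -nN. Qed.

Let rhoE m : rho m = second_moment_ratio m (N m).*2 (p (n m)).
Proof. by rewrite -nN. Qed.

Let zN_bounds m : x m <= z m * (N m)%:R <= 2 * x m.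
Proof.
have /andP[p0 p2] := p_half m.
have -> : z m * (N m)%:R = 2 * x m * (1 - p (n m)) by rewrite /z /x nNR; ring.
have x0 : 0 <= x m by rewrite /x mulr_ge0 // ltW.
have : 0 <= x m * (1 - 2 * p (n m)) by rewrite mulr_ge0 //; lra.
have : 0 <= x m * p (n m) by rewrite mulr_ge0 // ltW.
lra.
Qed.

Let x_le_N m : x m <= (N m)%:R.
Proof.
have /andP[p0 p2] := p_half m.
rewrite /x nNR; have : 0 <= (N m)%:R * (1 - 2 * p (n m)) by rewrite mulr_ge0 //; lra.
lra.
Qed.

Let near_x A : \forall m \near \oo, A <= x m.
Proof. by move/cvgryPge: x_oo; apply. Qed.

Let near_ln A : \forall m \near \oo, A <= ln m%:R :> R.
Proof. by have /cvgryPge := @cvg_lny_nat R; apply. Qed.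

Lemma second_moment_ratio_upper : \forall m \near \oo,
  rho m <= expR (193 * (m%:R / x m)) * (1 + 128 * (ln m%:R)^-1) + 512 * (x m)^-1.
Proof.
near=> m.
have x1 : 1 <= x m by near: m; exact: near_x.
have x192 : 192 <= x m by near: m; exact: near_x.
have m0 : (0 < m)%N by near: m; exact: nbhs_infty_gt.
have xN := x_le_N m; have nl := n_large m; rewrite nNR in nl.
have tail : (2 * (N m)%:R) ^+ (2 * m) * expR (- (2 * (N m)%:R / 128)) <=
    expR (- (2 * (N m)%:R / 256)) :> R.
  apply: exprn_mul_expR_le => //; apply: (@le_trans _ _ (x m)).
    by near: m; exact: near_x.
  by apply: (le_trans xN); rewrite ler_peMl // ler1n.
have l1 : 1 <= ln m%:R :> R by near: m; exact: near_ln.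
have mR : 1 <= m%:R :> R by rewrite ler1n.
have /andP[zx _] := zN_bounds m.
have N1 : 1 <= (N m)%:R :> R by apply: le_trans xN.
have Npos : (0 < N m)%N by rewrite -(ltr0n R); exact: lt_le_trans N1.
have ml0 : 0 <= m%:R * (ln m%:R - 1) :> R by rewrite mulr_ge0 // subr_ge0.
have m16 : (16 * m <= N m)%N by rewrite -(ler_nat R) natrM; lra.
have mlN : m%:R * ln m%:R <= (N m)%:R :> R by lra.
clear nl ml0; have zN192 : 192 <= z m * (N m)%:R := le_trans x192 zx.
rewrite rhoE; apply: (le_trans (second_moment_ratio_le (p_half m) Npos zN192 m16)).
clear zN192 x192 m16; rewrite -/(z m).
have x0 := lt_le_trans ltr01 x1; have l0 := lt_le_trans ltr01 l1.
apply: lerD.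
  apply: ler_pM; rewrite ?expR_ge0 ?addr_ge0 ?mulr_ge0 ?divr_ge0 //.
    rewrite ler_expR; do 2 apply: ler_wpM2l => //.
    by rewrite lef_pV2 ?posrE ?(lt_le_trans x0 zx).
  rewrite lerD2l -subr_ge0.
  have : m%:R / (N m)%:R <= 2 * (ln m%:R)^-1 :> R.
    by rewrite ler_pdivrMr 1?mulrAC ?ler_pdivlMr //; lra.
  lra.
apply: (@le_trans _ _ (4 * expR (- (2 * (N m)%:R / 256)))).
  rewrite ler_wpM2l //.
  by have -> : (N m)%:R / 64 = 2 * (N m)%:R / 128 :> R by field.
rewrite expRN.
(* A linear bound is enough here: exp (N / 128) >= x / 128, as x <= N. *)
have h : x m / 128 <= expR (2 * (N m)%:R / 256).
  by apply: le_trans (expR_ge1Dx _); lra.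
have : (expR (2 * (N m)%:R / 256))^-1 <= (x m / 128)^-1.
  by rewrite lef_pV2 ?posrE ?expR_gt0 ?divr_gt0.
rewrite invfM invrK; lra.
Unshelve. all: by end_near. Qed.

Lemma second_moment_ratio_cvg1 : (fun m => m%:R / x m) @ \oo --> (0 : R) ->
  rho @ \oo --> (1 : R).
Proof.
move=> mx0.
have x_near0 : \forall m \near \oo, 0 < x m.
  by near=> m; apply: (@lt_le_trans _ _ 1) => //; near: m; exact: near_x.
have l_near0 : \forall m \near \oo, 0 < ln m%:R :> R.
  by near=> m; apply: (@lt_le_trans _ _ 1) => //; near: m; exact: near_ln.
have xV : (fun m => (x m)^-1) @ \oo --> (0 : R) by apply/gtr0_cvgV0.
have lV : (fun m : nat => (ln m%:R : R)^-1) @ \oo --> (0 : R).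
  by apply/gtr0_cvgV0 => //; exact: cvg_lny_nat.
pose U m := expR (193 * (m%:R / x m)) * (1 + 128 * (ln m%:R)^-1) + 512 * (x m)^-1.
apply: (@squeeze_cvgr _ _ _ _ (fun=> 1) U) => //.
- near=> m; apply/andP; split; last by near: m; exact: second_moment_ratio_upper.
  by rewrite rhoE second_moment_ratio_ge1.
- exact: cvg_cst.
have -> : 1 = expR (193 * 0) * (1 + 128 * 0) + 512 * 0 :> R.
  by rewrite !mulr0 expR0 !addr0 mulr1.
apply: cvgD; last exact: cvgMr.
apply: cvgM; last by apply: cvgD; [exact: cvg_cst|exact: cvgMr].
by apply: continuous_cvg; [exact: continuous_expR|exact: cvgMr].
Unshelve. all: by end_near. Qed.

(** As z N <= 2 x, the available exponent is 2 c m / x with c = 1/4096. Half of it pays for the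
    prefactor, which eventually exceeds exp (- c / k) >= exp (- c m / x) because x <= k m. *)
Lemma second_moment_ratio_lower (k c : R) : 0 < k -> 0 < c -> c * 4096 = 1 ->
  (\forall m \near \oo, x m <= k * m%:R) ->
  \forall m \near \oo, expR (c * (m%:R / x m)) <= rho m.
Proof.
move=> k0 c0 c4096 xk.
pose b : R := expR (- (c / k)).
have b1 : 0 < 1 - b by rewrite subr_gt0 expR_lt1 oppr_lt0 divr_gt0.
near=> m.
have x768 : 768 <= x m by near: m; exact: near_x.
have xb : 4 * 64 / (1 - b) <= x m by near: m; exact: near_x.
have x_k : x m <= k * m%:R by near: m.
have lk : k <= ln m%:R :> R by near: m; exact: near_ln.
have /andP[zx zx2] := zN_bounds m; have xN := x_le_N m.
have x0 : 0 < x m by apply: lt_le_trans x768; rewrite ltr0n.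
have Npos : (0 < N m)%N by rewrite -(ltr0n R); exact: lt_le_trans x0 xN.
have NR : 0 < (N m)%:R :> R by rewrite ltr0n.
have zN768 : 768 <= z m * (N m)%:R := le_trans x768 zx.
have nl := n_large m; rewrite nNR in nl.
have m0 : 0 < m%:R :> R by rewrite -(pmulr_rgt0 _ k0); exact: lt_le_trans x0 x_k.
(* Eventually x <= k m <= m ln m <= N / 512, and z N <= 2 x, so the density is small enough for the
   lower bound. *)
have z64 : z m <= 1 / 64.
  rewrite -(ler_pM2r NR); apply: (le_trans zx2).
  have : k * m%:R <= ln m%:R * m%:R :> R by rewrite ler_wpM2r // ltW.
  lra.
rewrite rhoE; apply: le_trans (second_moment_ratio_ge m (p_half m) Npos zN768 z64).
rewrite -/(z m).
have d1 : expR ((2 * c) * (m%:R / x m)) <= expR (m%:R / (1024 * (z m * (N m)%:R))).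
  have zN0 := lt_le_trans x0 zx.
  have czN : c * (z m * (N m)%:R) <= c * (2 * x m) by rewrite ler_wpM2l // ltW.
  have x4 : c * 4096 * x m = x m by rewrite c4096 mul1r.
  rewrite ler_expR mulrCA ler_wpM2l ?(ltW m0) // ler_pdivrMr //.
  rewrite [leRHS]mulrC ler_pdivlMr; last by rewrite (pmulr_lgt0 _ zN0) ltr0n.
  lra.
clear nl x768 zN768 zx zx2 c4096 z64.
have d2 : b <= 1 - 4 * expR (- ((N m)%:R / 64)).
  have h : x m / 64 <= expR ((N m)%:R / 64).
    by apply: le_trans (expR_ge1Dx _); lra.
  have : expR (- ((N m)%:R / 64)) <= 64 / x m.
    by rewrite expRN -[leRHS]invf_div lef_pV2 ?posrE ?expR_gt0 ?divr_gt0.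
  have : 64 / x m <= (1 - b) / 4.
    rewrite ler_pdivrMr // mulrAC ler_pdivlMr //.
    by rewrite [leLHS]mulrC [leRHS]mulrC -ler_pdivrMr.
  lra.
have d3 : expR (- (c * (m%:R / x m))) <= b.
  rewrite ler_expR lerN2 ler_wpM2l ?(ltW c0) // ler_pdivlMr // mulrC.
  by rewrite ler_pdivrMr // mulrC.
apply: (@le_trans _ _ (expR (- (c * (m%:R / x m))) * expR ((2 * c) * (m%:R / x m)))).
  by rewrite -expRD ler_expR; move: (m%:R / x m) => y; lra.
by apply: ler_pM; rewrite ?expR_ge0 //; apply: le_trans d2.
Unshelve. all: by end_near. Qed.

End Asymptotics.

Theorem theorem3 (R : realType) :
  exists2 C : R, 0 < C &
  forall (n : nat -> nat) (p : nat -> R),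
    (forall m : nat, ~~ odd (n m)) ->
    (forall m : nat, 0 < p (n m) <= 2^-1) ->
    (forall m : nat, C * m%:R * ln m%:R <= (n m)%:R) ->
    (fun m : nat => (n m)%:R * p (n m)) @ \oo --> +oo ->
    ((fun m : nat => m%:R : R^o) =o_\oo (fun m : nat => (n m)%:R * p (n m) : R^o) ->
       (fun m : nat => second_moment_ratio m (n m) (p (n m))) @ \oo --> (1 : R))
    /\
    ((fun m : nat => m%:R : R^o) \is 'Omega_\oo (fun m : nat => (n m)%:R * p (n m) : R^o) ->
       exists2 c : R, 0 < c &
         \forall m \near \oo,
           expR (c * (m%:R / ((n m)%:R * p (n m)))) <=
           second_moment_ratio m (n m) (p (n m))).
Proof.
have c1024 : 0 < 1024 :> R by rewrite ltr0n.
(* The constant required by [exprn_mul_expR_le]. *)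
exists 1024; first exact: c1024.
move=> n p n_even p_half n_large x_oo.
have h4096 : 0 < 4096 :> R by rewrite ltr0n.
have c0 : 0 < 4096^-1 :> R by rewrite invr_gt0.
have c1 := mulVf (lt0r_neq0 h4096).
have x_ge0 m : 0 <= (n m)%:R * p (n m) by case/andP: (p_half m) => p0 _; rewrite mulr_ge0 // ltW.
split=> [mx|].
  apply: second_moment_ratio_cvg1 => //; apply/cvgr0Pnorm_le => e e0.
  have x_gt0 : \forall m \near \oo, 1 <= (n m)%:R * p (n m).
    by move/cvgryPge: x_oo; apply.
  have /eqoP/(_ e e0) mx_e := mx.
  near=> m.
  have x0 : 0 < (n m)%:R * p (n m) by apply: (@lt_le_trans _ _ 1) => //; near: m.
  rewrite ger0_norm ?divr_ge0 // ler_pdivrMr //.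
  have : `|m%:R : R^o| <= e * `|(n m)%:R * p (n m) : R^o| by near: m.
  by rewrite !ger0_norm.
(* The hypothesis is read as n p = O(m), which provides [k]. *)
rewrite eqOmegaO => /eqO_exP[k k0 xk].
exists 4096^-1; first exact: c0.
apply: (second_moment_ratio_lower n_even p_half n_large x_oo k0 c0 c1).
near=> m.
have : `|(n m)%:R * p (n m) : R^o| <= k * `|m%:R : R^o| by near: m.
by rewrite !ger0_norm.
Unshelve. all: by end_near. Qed.
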